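(* Let $M\in\mathrm{SL}(2,\mathbb{Z})$ be a hyperbolic matrix with eigenvalues $\beta,\beta^{-1}$, where $\beta>1$, let $T:\mathbb{T}^2\to\mathbb{T}^2$, $T\omega=M\omega \bmod \mathbb{Z}^2$, and let $\vec u\in\mathbb{R}^2$ be an eigenvector of $M$ for the eigenvalue $\beta$. Let $v:\mathbb{T}^2\to\mathbb{R}$ be a bounded measurable function such that (i) $v\in C^1([0,1)^2,\mathbb{R})$, and (ii) there is a constant $c>0$ such that $D_{\vec u}v(\omega)>c$ for all $\omega\in\mathbb{T}^2$. Let $L(E;\lambda)$ be the Lyapunov exponent at energy $E$ of the Schrödinger cocycle over $T$ with potential $\lambda v$. Then there exists $C_0=C_0(v)>0$ such that for every $\lambda>0$ $$L(E;\lambda)>\log\lambda-C_0\quad\text{for all }E\in\mathbb{R}.$$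
   Context: $\mathbb{T}^2=\mathbb{R}^2/\mathbb{Z}^2$ is identified with the fundamental domain $[0,1)^2$ and carries Lebesgue measure $\mu$. A function $v$ on $\mathbb{T}^2$ is regarded as a function on $[0,1)^2$; condition (i) concerns $v$ on $[0,1)^2$ only, so $v$ may be discontinuous as a function on $\mathbb{T}^2$ across the boundary of the fundamental domain. $D_{\vec u}v=u_1\partial_{\omega_1}v+u_2\partial_{\omega_2}v$ is the directional derivative. The Schrödinger operators are $[H_{\lambda,v,\omega}\psi]_n=\psi_{n+1}+\psi_{n-1}+\lambda v(T^n\omega)\psi_n$ on $\ell^2(\mathbb{Z})$. For $E\in\mathbb{R}$, $\lambda>0$, put $$A^{(E-\lambda v)}(\omega)=\begin{pmatrix}E-\lambda v(\omega)&-1\\1&0\end{pmatrix}\in\mathrm{SL}(2,\mathbb{R}),\qquad A_n^{(E-\lambda v)}(\omega)=A^{(E-\lambda v)}(T^{n-1}\omega)\cdots A^{(E-\lambda v)}(\omega)\quad (n\ge1).$$ The Lyapunov exponent is $$L(E;\lambda)=\lim_{n\to\infty}\frac1n\int_{\mathbb{T}^2}\log\|A_n^{(E-\lambda v)}(\omega)\|\,d\mu(\omega)=\inf_{n\ge1}\frac1n\int_{\mathbb{T}^2}\log\|A_n^{(E-\lambda v)}(\omega)\|\,d\mu(\omega)\ge 0.$$ The constant $C_0$ does not depend on $\lambda$ or $E$. *)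

(* Defs.v *)
From HB Require Import structures.
From mathcomp Require Import all_boot all_order all_algebra.
From mathcomp Require Import all_classical all_reals all_analysis.
From mathcomp Require Import complex.

Set Implicit Arguments.
Unset Strict Implicit.
Unset Printing Implicit Defensive.

Import Order.TTheory GRing.Theory Num.Theory.
Import numFieldNormedType.Exports.

Local Open Scope classical_set_scope.
Local Open Scope ring_scope.

(** The torus R^2/Z^2 is represented by its fundamental domain [0,1)^2:
    functions on the torus are functions [R * R -> R] of which only the values
    on [unit_square R] matter. *)
Definition unit_square (R : realType) : set (R * R) := `[0, 1[ `*` `[0, 1[.
Arguments unit_square : clear implicits.

Definition frac (R : realType) (x : R) : R := x - (Num.floor x)%:~R.

Definition mx_real (R : realType) (M : 'M[int]_2) : 'M[R]_2 := map_mx intr M.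

Definition toral_map (R : realType) (M : 'M[int]_2) (w : R * R) : R * R :=
  let A := mx_real R M in
  (frac (A 0 0 * w.1 + A 0 1 * w.2), frac (A 1 0 * w.1 + A 1 1 * w.2)).

Definition hyperbolic (R : realType) (M : 'M[int]_2) : Prop :=
  forall z : R[i], eigenvalue (map_mx intr M : 'M[R[i]]_2) z -> `|z| != 1.

(** Derivative of [v] at [w] in direction [e] relative to the unit square: the
    difference quotient only uses points of the square, so the derivative is
    one-sided at the points of the square lying on its boundary. *)
Definition quotient_at (R : realType) (v : R * R -> R) (e w : R * R) (h : R) : R :=
  h^-1 * (v (w.1 + h * e.1, w.2 + h * e.2) - v w).

Definition steps (R : realType) (e w : R * R) : set_system R :=
  within [set h | unit_square R (w.1 + h * e.1, w.2 + h * e.2)] 0^'.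

Definition derivable_sq (R : realType) (v : R * R -> R) (e w : R * R) : Prop :=
  cvg (quotient_at v e w @ steps e w).

Definition derive_sq (R : realType) (v : R * R -> R) (e w : R * R) : R :=
  lim (quotient_at v e w @ steps e w).

Definition e1 (R : realType) : R * R := (1, 0).
Definition e2 (R : realType) : R * R := (0, 1).
Arguments e1 : clear implicits.
Arguments e2 : clear implicits.

Definition C1_square (R : realType) (v : R * R -> R) : Prop :=
  forall e, e = e1 R \/ e = e2 R ->
    (forall w, unit_square R w -> derivable_sq v e w) /\
    {within unit_square R, continuous (derive_sq v e)}.

Definition dir_derive (R : realType) (u : 'cV[R]_2) (v : R * R -> R)
    (w : R * R) : R :=
  u 0 0 * derive_sq v (e1 R) w + u 1 0 * derive_sq v (e2 R) w.

Definition enorm (R : realType) (x : 'cV[R]_2) : R :=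
  Num.sqrt (x 0 0 ^+ 2 + x 1 0 ^+ 2).

Definition opnorm (R : realType) (A : 'M[R]_2) : R :=
  sup [set enorm (A *m x) | x in [set x | enorm x = 1]].

Definition schrodinger_mx (R : realType) (E lambda : R) (v : R * R -> R)
    (w : R * R) : 'M[R]_2 :=
  \matrix_(i, j) (if i == 0 then if j == 0 then E - lambda * v w else - 1
                  else if j == 0 then 1 else 0).

Fixpoint cocycle (R : realType) (M : 'M[int]_2) (E lambda : R)
    (v : R * R -> R) (n : nat) (w : R * R) : 'M[R]_2 :=
  if n is k.+1 then
    schrodinger_mx E lambda v (iter k (toral_map M) w)
      *m cocycle M E lambda v k w
  else 1%:M.

Definition lyapunov (R : realType) (M : 'M[int]_2) (v : R * R -> R)
    (E lambda : R) : R :=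
  limn (fun n : nat => n%:R^-1 *
    \int[(@lebesgue_measure R \x @lebesgue_measure R)%E]_(w in unit_square R)
      ln (opnorm (cocycle M E lambda v n w))).

(* Main.v *)
(* Every unstable leaf x |-> (x, y + r x), with r = u_2 / u_1, is mapped by T^k
   to a leaf traversed at speed beta^k, so along it v o T^k has slope at least
   c beta^k / |u_1| (up to the sign of u_1) away from O(beta^k) jumps.  Let psi_n
   be the upper left entry of A_n.  The ratios f_k = psi_{k+1} / psi_k satisfy
   f_{k+1} = E - lambda v o T^{k+1} - 1 / f_k, and -1/f is decreasing where f is
   decreasing and of constant sign; hence, up to sign, f_k decreases
   with slope at most -lambda c beta^k / |u_1| on each of O(beta^k) pieces.  On a
   piece, |f_k(x)| >= lambda c beta^k |x - z| / |u_1|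
   for some z, so ln lambda - ln |f_k| is at most a sum of O(beta^k) logarithmic
   poles of width O(beta^{-k}), whose integral is bounded independently of k,
   lambda and E.  Summing over k < n and averaging over the leaves bounds the
   mean of ln |psi_n|, hence of ln ||A_n||, below by n (ln lambda - C).
   The limit exists by Fekete's lemma, T being measure preserving. *)
Require Import Defs.
From mathcomp Require Import all_boot all_order all_algebra.
From mathcomp Require Import all_classical all_reals all_analysis.
From mathcomp Require Import measurable_realfun.
From mathcomp Require Import ring lra zify.

Import Order.TTheory GRing.Theory Num.Theory.
Import numFieldNormedType.Exports.

Set Implicit Arguments.
Unset Strict Implicit.
Unset Printing Implicit Defensive.

Local Open Scope classical_set_scope.
Local Open Scope ring_scope.

(* [fraction.frac] from mathcomp shadows [frac]. *)
Local Notation frac := Defs.frac.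

(** * Piecewise decreasing functions and the Riccati recursion *)

Section PiecewiseDecreasing.
Variable R : realType.
Implicit Types (S : seq R) (f g : R -> R) (m : R).

Definition free S (x y : R) := forall s, s \in S -> ~~ (x <= s <= y).

(** Slope at most [-m] on each component of [[0, 1)] minus [S], expressed by increments so that [f]
    may jump or blow up at points of [S]. *)
Definition decr m S f := forall x y,
  0 <= x -> x < y -> y < 1 -> free S x y -> f y + m * (y - x) <= f x.

Lemma free_sub S S' x y : {subset S <= S'} -> free S' x y -> free S x y.
Proof. by move=> sub fr s /sub /fr. Qed.

Lemma free_notin S x y z : free S x y -> x <= z <= y -> z \notin S.
Proof. by move=> fr xzy; apply/negP => /fr; rewrite xzy. Qed.

(** The largest point of [0 :: S] in [[0, x]] labels the component of [x]; the extra [0] serves the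
    leftmost component. *)
Lemma component_left S (x : R) : 0 <= x ->
  exists2 s, s \in 0 :: S &
    0 <= s <= x /\ forall s', s' \in S -> ~~ (s < s' <= x).
Proof.
move=> x0; elim: S => [|a S [s sS [/andP[s0 sx] IH]]].
  by exists 0; rewrite ?mem_head // lexx x0.
have [ax|xa] := boolP (s < a <= x).
  case/andP: ax => sa ax; exists a; first by rewrite !inE eqxx orbT.
  rewrite (le_trans s0 (ltW sa)) ax.
  split=> // s'; rewrite inE => /predU1P[->|/IH]; first by rewrite ltxx.
  by apply: contra => /andP[/(lt_trans sa) -> ->].
exists s; first by move: sS; rewrite !inE => /orP[->|->]; rewrite ?orbT.
by rewrite s0 sx; split=> // s'; rewrite inE => /predU1P[->|/IH].
Qed.

Let component S (s x : R) :=
  [/\ 0 <= x < 1, 0 <= s <= x, x \notin S & forall s', s' \in S -> ~~ (s < s' <= x)].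

Let component_free S s x y : component S s x -> component S s y -> free S x y.
Proof.
move=> [_ /andP[_ sx] xS _] [_ _ _ yS] t tS; apply/negP => /andP[xt ty].
have := yS _ tS; rewrite ty andbT -leNgt => ts.
by move/negP: xS; apply; rewrite (_ : x = t) //; apply: le_anti; rewrite xt (le_trans ts).
Qed.

(* To each component of the complement of [S] one adds the point at which the
   decreasing function [f] changes sign there. *)
Lemma crossings m S f : 0 < m -> decr m S f -> exists S',
  [/\ (size S' <= 2 * size S + 1)%N, {subset S <= S'},
   forall x, 0 <= x < 1 -> x \notin S' ->
     exists2 z, z \in S' & m * `|x - z| <= `|f x| &
   forall x y, 0 <= x -> x < y -> y < 1 -> free S' x y -> 0 < f x * f y].
Proof.
move=> m0 df.
(* The sign change in the component labelled [s] is placed at the supremum [z s] of its points with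
   [0 <= f]. Adding [s] keeps the set nonempty when [f] is negative throughout. *)
pose E s := [set y | y = s \/ component S s y /\ 0 <= f y].
pose z s := sup (E s).
have supE s : has_sup (E s).
  split; first by exists s; left.
  exists (Num.max s 1) => y [->|[[/andP[_ y1] _ _ _] _]]; rewrite le_max ?lexx//.
  by rewrite (ltW y1) orbT.
have pos s x : component S s x -> 0 <= f x -> x <= z s /\ m * (z s - x) <= f x.
  move=> cx fx0; split; first by apply: ub_le_sup; [case: (supE s)|right].
  suff : z s <= x + f x / m by rewrite -lerBlDl ler_pdivlMr // mulrC.
  apply: ge_sup; first by case: (supE s).
  have q0 : 0 <= f x / m by rewrite divr_ge0 // ltW.
  move=> y [->|[cy fy]]; first by case: cx => _ /andP[_ ?] _ _; lra.
  have [yx|xy] := leP y x; first by lra.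
  have := df x y; case: (cx) => /andP[x0 _] _ _ _; case: (cy) => /andP[_ y1] _ _ _.
  move=> /(_ x0 xy y1 (component_free cx cy)) h.
  rewrite -lerBlDl ler_pdivlMr // mulrC; lra.
have neg s x : component S s x -> f x < 0 -> z s <= x /\ m * (x - z s) <= - f x.
  move=> cx fx0; have zx : z s <= x.
    apply: ge_sup; first by case: (supE s).
    move=> y [->|[cy fy]]; first by case: cx => _ /andP[].
    have [//|xy] := leP y x.
    have := df x y; case: (cx) => /andP[x0 _] _ _ _; case: (cy) => /andP[_ y1] _ _ _.
    move=> /(_ x0 xy y1 (component_free cx cy)).
    have : 0 <= m * (y - x) by rewrite mulr_ge0 ?ltW // subr_gt0.
    lra.
  split=> //; rewrite leNgt; apply/negP => lt.
  have q0 : 0 < - f x / m by rewrite divr_gt0 // oppr_gt0.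
  have qz : - f x / m < x - z s by rewrite ltr_pdivrMr // mulrC.
  (* [w] is the midpoint of [z s] and [x + f x / m]. Lying beyond [z s] it has [f w < 0], yet it is
     so far from [x] that the slope forces [f w > 0]. *)
  pose w := x - (x - z s + (- f x / m)) / 2.
  have wx : w < x by rewrite /w; lra.
  have zw : z s < w by rewrite /w; lra.
  have sw : s < w by apply: le_lt_trans zw; apply: ub_le_sup; [case: (supE s)|left].
  case: (cx) => /andP[x0 x1] /andP[s0 sx] xS hx.
  have w0 : 0 <= w by apply: le_trans (ltW sw).
  have cw : component S s w.
    split; rewrite ?w0 ?s0 ?(ltW sw) ?(lt_trans wx) //.
      by apply/negP => /hx; rewrite sw (ltW wx).
    move=> t /hx; apply: contra => /andP[-> tw]; exact: le_trans tw (ltW wx).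
  have fw : f w < 0.
    rewrite ltNge; apply/negP => fw; move: zw; apply/negP; rewrite -leNgt.
    by apply: ub_le_sup; [case: (supE s)|right].
  have := df w x w0 wx x1 (component_free cw cx).
  have : - f x < m * (x - w).
    by rewrite -ltr_pdivrMl // mulrC /w; lra.
  lra.
have comp x : 0 <= x < 1 -> x \notin S -> exists2 s, s \in 0 :: S & component S s x.
  move=> /[dup] x01 /andP[x0 _] xS; have [s sS [sx hs]] := component_left S x0.
  by exists s.
have sign x : 0 <= x < 1 -> x \notin S -> exists2 t, t \in map z (0 :: S) & m * `|x - t| <= `|f x|.
  move=> x01 xS; have [s sS cx] := comp x x01 xS.
  exists (z s); first exact: map_f.
  have [fx|fx] := leP 0 (f x).
    by have [xz h] := pos _ _ cx fx; rewrite ler0_norm ?subr_le0 // ger0_norm // opprB.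
  by have [zx h] := neg _ _ cx fx; rewrite ger0_norm ?subr_ge0 // ltr0_norm.
exists (S ++ map z (0 :: S)); split.
- by rewrite size_cat size_map /=; lia.
- by move=> s sS; rewrite mem_cat sS.
- move=> x x01; rewrite mem_cat negb_or => /andP[xS _].
  by have [t tS] := sign x x01 xS; exists t => //; rewrite mem_cat tS orbT.
- move=> x y x0 xy y1 fr.
  have nz t : x <= t <= y -> f t != 0.
    move=> /[dup] xty /andP[xt ty].
    have := free_notin fr xty; rewrite mem_cat negb_or => /andP[tS tz].
    have [|u uz] := sign t _ tS; first by apply/andP; lra.
    rewrite -normr_gt0; apply: lt_le_trans; rewrite mulr_gt0 // normr_gt0 subr_eq0.
    by apply: contraNneq tz => ->.
  have fx0 := nz x; rewrite lexx (ltW xy) in fx0; have {}fx0 := fx0 isT.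
  have fy0 := nz y; rewrite lexx (ltW xy) in fy0; have {}fy0 := fy0 isT.
  have frS : free S x y by apply: free_sub fr => s sS; rewrite mem_cat sS.
  have fxy := df x y x0 xy y1 frS.
  have {}fxy : f y < f x by have : 0 < m * (y - x) by [rewrite mulr_gt0 // subr_gt0]; lra.
  have [s sS cx] : exists2 s, s \in 0 :: S & component S s x.
    by apply: comp; [apply/andP; lra|apply: (free_notin frS); rewrite lexx ltW].
  have cy : component S s y.
    case: (cx) => _ /andP[s0 sx] xS hs; split.
    + by apply/andP; lra.
    + by apply/andP; lra.
    + by apply: (free_notin frS); rewrite lexx ltW.
    + move=> t tS; apply/negP => /andP[st ty]; have [tx|xt] := leP t x.
        by have := hs _ tS; rewrite st tx.
      by have := frS _ tS; rewrite (ltW xt) ty.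
  (* The remaining case [f y < 0 < f x] would put [z s], a point of the new list, between [x] and
     [y]. *)
  have [fy|fy] := ltP 0 (f y); first by rewrite mulr_gt0 // (lt_trans fy).
  have {}fy : f y < 0 by rewrite lt_neqAle fy0.
  have [fx|fx] := leP (f x) 0.
    by rewrite nmulr_rgt0 // lt_neqAle fx0.
  have [xz _] := pos _ _ cx (ltW fx); have [zy _] := neg _ _ cy fy.
  have := fr (z s); rewrite xz zy mem_cat (map_f z sS) orbT => /(_ isT) //.
Qed.

(** On either half-line [t |-> -1/t] is increasing, so [-1/f] does not increase where [f] keeps its
    sign, and adding it preserves the slope bound of [g]. *)
Lemma decr_inv S S' m m' f g : decr m S f ->  0 <= m ->
  (forall x y, 0 <= x -> x < y -> y < 1 -> free S x y -> 0 < f x * f y) ->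
  decr m' S' g -> decr m' (S ++ S') (fun x => g x - (f x)^-1).
Proof.
move=> df m0 sf dg x y x0 xy y1 fr.
have fr1 : free S x y by apply: free_sub fr => s sS; rewrite mem_cat sS.
have fr2 : free S' x y by apply: free_sub fr => s sS; rewrite mem_cat sS orbT.
have := dg x y x0 xy y1 fr2; have := df x y x0 xy y1 fr1.
have : 0 <= m * (y - x) by rewrite mulr_ge0 // subr_ge0 ltW.
have := sf x y x0 xy y1 fr1 => p ? ? ?.
suff : (f x)^-1 <= (f y)^-1 by lra.
have fx0 : f x != 0 by apply: contraTneq p => ->; rewrite mul0r ltxx.
have fy0 : f y != 0 by apply: contraTneq p => ->; rewrite mulr0 ltxx.
rewrite -subr_ge0.
have -> : (f y)^-1 - (f x)^-1 = (f x - f y) / (f x * f y) by field; rewrite fx0 fy0.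
rewrite divr_ge0 ?(ltW p) //; lra.
Qed.

(** The ratio of consecutive values of [transfer g], as long as no earlier ratio vanishes. The
    convention [0^-1 = 0] makes the recursion total. *)
Fixpoint riccati (g : nat -> R -> R) (n : nat) (x : R) : R :=
  if n is k.+1 then g n x - (riccati g k x)^-1 else g 0 x.

(* The count of pieces at most doubles at each step, up to [C * beta ^ k] new
   discontinuities; as [2 < beta] it stays comparable to [beta ^ n]. *)
Lemma riccati_zeros (a beta C : R) (g : nat -> R -> R) (D : nat -> seq R) :
  0 < a -> 2 < beta -> 0 <= C ->
  (forall n, decr (a * beta ^+ n) (D n) (g n)) ->
  (forall n, (size (D n))%:R <= C * beta ^+ n) ->
  forall n, exists2 Z : seq R,
    (size Z)%:R <= 2 * ((C + 1) * beta / (beta - 2)) * beta ^+ n &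
    forall x, 0 <= x < 1 -> x \notin Z ->
      exists2 z, z \in Z & a * beta ^+ n * `|x - z| <= `|riccati g n x|.
Proof.
move=> a0 b2 C0 dg sD n; set K := _ / _.
have K0 : 0 <= K by rewrite /K divr_ge0 ?mulr_ge0 //; lra.
have Kb : K * (beta - 2) = (C + 1) * beta by rewrite /K; field; lra.
have K1 : C + 1 <= K by rewrite /K ler_pdivlMr ?ler_wpM2l //; lra.
have m0 k : 0 < a * beta ^+ k by rewrite mulr_gt0 // exprn_gt0 //; lra.
(* Counting [size S + 1] turns the bound [2 * size S + 1] of [crossings] into a doubling. The choice
   of [K] gives [2 * K + C * beta <= K * beta] for the step and [C + 1 <= K] for the start. *)
have [S sS dS] : exists2 S, (size S)%:R + 1 <= K * beta ^+ n & decr (a * beta ^+ n) S (riccati g n).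
  elim: n => [|n [S sS dS]].
    exists (D 0%N); last exact: dg.
    by have := sD 0%N; rewrite !expr0 !mulr1; lra.
  have [S' [sS' sub _ sgn]] := crossings (m0 n) dS.
  exists (S' ++ D n.+1); last first.
    apply: (decr_inv (m := a * beta ^+ n) (f := riccati g n) _ (ltW (m0 n)) sgn (dg n.+1)).
    by move=> x y x0 xy y1 fr; apply: dS => //; apply: free_sub fr.
  rewrite size_cat natrD; have := sD n.+1; move: sS'; rewrite -(ler_nat R) natrD natrM.
  have : 1 <= beta ^+ n by rewrite exprn_ege1 //; lra.
  rewrite !exprS; move: sS; move: (beta ^+ n) => B sS B1 h1 h2.
  have : (K * (beta - 2) - (C + 1) * beta) * B = 0 by rewrite Kb subrr mul0r.
  have : 1 <= beta * B by nra.
  lra.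
have [Z [sZ _ hZ _]] := crossings (m0 n) dS.
exists Z => //; move: sZ; rewrite -(ler_nat R) natrD natrM; lra.
Qed.

(** The three-term recurrence of the upper left entry of a product of Schrodinger matrices with
    diagonal entries [g 0], [g 1], and so on. *)
Fixpoint transfer (g : nat -> R -> R) (n : nat) (x : R) : R :=
  match n with
  | 0 => 1
  | 1 => g 0 x
  | (k.+1 as l).+1 => g l x * transfer g l x - transfer g k x
  end.

Lemma transferS (g : nat -> R -> R) n x : (forall k, (k < n)%N -> riccati g k x != 0) ->
  transfer g n.+1 x = riccati g n x * transfer g n x.
Proof.
elim: n => [|n IH] nz; first by rewrite /= mulr1.
have {}IH := IH (fun k kn => nz k (ltnW kn)).
have nzn := nz n (ltnSn n).
rewrite [LHS]/= -/(transfer g n.+1 x) IH /=; field; exact: nzn.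
Qed.

Lemma ln_transfer (g : nat -> R -> R) n x : (forall k, (k < n)%N -> riccati g k x != 0) ->
  transfer g n x != 0 /\ ln `|transfer g n x| = \sum_(k < n) ln `|riccati g k x|.
Proof.
elim: n => [|n IH] nz; first by rewrite big_ord0 /= normr1 ln1 oner_eq0.
have [|t0 IH'] := IH; first by move=> k /ltnW/nz.
rewrite transferS; last by move=> k /ltnW/nz.
have r0 := nz n (ltnSn n).
rewrite mulf_neq0 // big_ord_recr /= -IH' normrM lnM ?posrE ?normr_gt0 //.
by rewrite addrC.
Qed.

End PiecewiseDecreasing.

(** * Measure-preserving maps of the unit square *)

Section Fractional.
Variable R : realType.
Implicit Types x y a : R.

Lemma frac_itv x : 0 <= frac x < 1.
Proof. by have := floor_itv x; rewrite intrD /frac /=; lra. Qed.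

Lemma frac_unique (n : int) x : n%:~R <= x < n%:~R + 1 -> frac x = x - n%:~R.
Proof. by move=> h; rewrite /frac (@floor_def _ x n) // intrD. Qed.

Lemma frac_id x : 0 <= x < 1 -> frac x = x.
Proof. by move=> h; rewrite (@frac_unique 0) ?subr0 //= add0r. Qed.

Lemma frac_addz x y : y \is a Num.int -> frac (x + y) = frac x.
Proof.
move=> yz; rewrite /frac floorDrz // intrD (floorK yz).
by rewrite opprD addrACA subrr addr0.
Qed.

Lemma frac_sub x : frac x - x \is a Num.int.
Proof. by rewrite /frac addrC addrA addNr add0r rpredN intr_int. Qed.

Lemma measurable_frac : measurable_fun [set: R] (@frac R).
Proof.
apply: measurable_funB => //; apply: nondecreasing_measurable => //.
by move=> x y xy; rewrite ler_int le_floor.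
Qed.

Lemma frac_eqP x y : x - y \is a Num.int -> frac x = frac y.
Proof. by move=> h; rewrite -(@frac_addz y (x - y)) // addrC subrK. Qed.

End Fractional.

Section MeasurePreserving.
Variable R : realType.
Local Notation mu := (@lebesgue_measure R).
Local Notation I := (`[0 : R, 1[%classic).
Local Open Scope ereal_scope.

Lemma lebesgue_measure_shift (c : R) (A : set R) : measurable A ->
  pushforward mu (fun x : R => (x + c)%R : measurableTypeR R) A = mu A.
Proof.
move=> mA; apply/esym.
have mc : measurable_fun [set: R] (fun x : R => (x + c)%R : measurableTypeR R).
  exact: measurable_funD.
apply: lebesgue_measure_unique => //=.
move=> _ [[a b]] _ <-.
rewrite /pushforward (_ : _ @^-1` _ = `](a - c)%R, (b - c)%R]%classic); last first.
  by apply/seteqP; split => x /=; rewrite !in_itv /= ltrBlDr lerBrDr.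
rewrite !lebesgue_measure_itv /= !lte_fin ltrD2r.
by case: ifP => // _; rewrite -!EFinD; congr EFin; ring.
Qed.

Lemma ge0_integral_shift (c : R) (D : set R) (f : R -> \bar R) :
  measurable D -> measurable_fun D f -> (forall x, D x -> 0 <= f x) ->
  \int[mu]_(x in [set x | D (x + c)%R]) f (x + c)%R = \int[mu]_(x in D) f x.
Proof.
move=> mD mf f0.
have mc : measurable_fun [set: R] (fun x : R => (x + c)%R : measurableTypeR R).
  exact: measurable_funD.
have := @ge0_integral_pushforward _ _ (measurableTypeR R) (measurableTypeR R) R _ mc mu D f mD mf.
move=> <-; last by move=> x; rewrite inE => /f0.
by apply: eq_measure_integral => A mA _; exact: lebesgue_measure_shift.
Qed.

(** A rotation of the circle exchanges two intervals: with [t = frac a], [[0, 1 - t)] moves by [t]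
    onto [[t, 1)] and [[1 - t, 1)] moves by [t - 1] onto [[0, t)]. *)
Lemma integral_frac_shift (a : R) (f : R -> \bar R) :
  measurable_fun I f -> (forall x, I x -> 0 <= f x) ->
  \int[mu]_(x in I) f (frac (x + a)) = \int[mu]_(x in I) f x.
Proof.
move=> mf f0; pose t := frac a.
have := frac_itv a; rewrite -/t => t01.
under eq_integral => x _.
  rewrite (_ : frac (x + a) = frac (x + t)); last first.
    apply: frac_eqP; rewrite opprD addrACA subrr add0r -opprB rpredN; exact: frac_sub.
  over.
clearbody t.
have split2 (b : R) : (0 <= b <= 1)%R -> I = `[0%R, b[ `|` `[b, 1%R[.
  move=> b01; apply/seteqP; split => x /=; rewrite !in_itv /=.
    by move=> x01; have [xb|bx] := ltP x b; [left|right]; lra.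
  by case=> h; lra.
have disj (b : R) : [disjoint `[0%R, b[%classic & `[b, 1%R[%classic].
  apply/disj_setPS => x [] /=; rewrite !in_itv /=; lra.
have mft : measurable_fun I (fun x => f (frac (x + t))).
  apply: (measurable_comp (F := I)) => //.
    by move=> _ [x _ <-]; rewrite /= in_itv /=; exact: frac_itv.
  apply: (measurable_funTS (D := I)); apply: measurableT_comp; first exact: measurable_frac.
  exact: measurable_funD.
have f0t x : 0 <= f (frac (x + t)).
  by apply: f0; rewrite /= in_itv /=; exact: frac_itv.
have e1 : (0 <= 1 - t <= 1)%R by lra.
have e2 : (0 <= t <= 1)%R by lra.
have splitI (b : R) (g : R -> \bar R) : (0 <= b <= 1)%R -> measurable_fun I g ->
    (forall x, I x -> 0 <= g x) ->
    \int[mu]_(x in I) g x =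
    \int[mu]_(x in `[0%R, b[) g x + \int[mu]_(x in `[b, 1%R[) g x.
  move=> /split2 E mg g0; rewrite [in LHS]E.
  by apply: ge0_integral_setU => //; rewrite -E.
rewrite (splitI _ _ e1 mft) // (splitI _ _ e2 mf f0).
rewrite addeC; congr (_ + _).
- rewrite -(@ge0_integral_shift (t - 1) `[0%R, t[) //; last 2 first.
  + by apply: measurable_funS mf => // x /=; rewrite !in_itv /=; lra.
  + by move=> x /=; rewrite in_itv /= => h; apply: f0; rewrite /= in_itv /=; lra.
  rewrite (_ : [set x | _ (x + (t - 1))%R] = `[(1 - t)%R, 1%R[%classic); last first.
    by apply/seteqP; split => x /=; rewrite !in_itv /=; lra.
  apply: eq_integral => x; rewrite inE /= in_itv /= => h.
  by rewrite (@frac_unique _ 1) mulr1z ?addrA //; lra.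
- rewrite -(@ge0_integral_shift t `[t, 1%R[) //; last 2 first.
  + by apply: measurable_funS mf => // x /=; rewrite !in_itv /=; lra.
  + by move=> x /=; rewrite in_itv /= => h; apply: f0; rewrite /= in_itv /=; lra.
  rewrite (_ : [set x | _ (x + t)%R] = `[0%R, (1 - t)%R[%classic); last first.
    by apply/seteqP; split => x /=; rewrite !in_itv /=; lra.
  apply: eq_integral => x; rewrite inE /= in_itv /= => h.
  by rewrite frac_id //; lra.
Qed.

Local Notation mu2 := (mu \x mu).
Local Notation Q := (unit_square R).

Lemma measurable_unit_square : measurable Q.
Proof. exact: measurableX. Qed.

(** Tonelli is applied on the plane to the extension by zero, which splits into extensions by zero
    in each variable. *)
Lemma patch_square1 (F : R * R -> \bar R) x y :
  (F \_ Q) (x, y) = ((fun x => ((fun y => F (x, y)) \_ I) y) \_ I) x.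
Proof.
rewrite !patchE; have [xI|xI] := boolP (x \in I); last first.
  by rewrite memNset // => -[/= xx _]; move: xI; rewrite notin_setE; apply.
have [yI|yI] := boolP (y \in I); last first.
  by rewrite memNset // => -[/= _ yy]; move: yI; rewrite notin_setE; apply.
by rewrite mem_set //; split; apply: set_mem.
Qed.

Lemma integral_square1 (F : R * R -> \bar R) :
  measurable_fun Q F -> (forall w, Q w -> 0 <= F w) ->
  \int[mu2]_(w in Q) F w = \int[mu]_(x in I) \int[mu]_(y in I) F (x, y).
Proof.
move=> mF F0; rewrite integral_mkcond.
have mP : measurable_fun setT (F \_ Q).
  by apply/(measurable_restrictT _ measurable_unit_square).
rewrite fubini_tonelli1 //; last first.
  by move=> w; rewrite patchE; case: ifPn => // /set_mem; exact: F0.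
rewrite [RHS]integral_mkcond; apply: eq_integral => x _.
rewrite /fubini_F patchE; case: ifPn => xI.
  by rewrite [RHS]integral_mkcond; apply: eq_integral => y _; rewrite patch_square1 patchE xI.
by apply: integral0_eq => y _; rewrite patch_square1 patchE (negbTE xI).
Qed.

Lemma fubini_G_square (F : R * R -> \bar R) y : I y ->
  fubini_G mu (F \_ Q) y = \int[mu]_(x in I) F (x, y).
Proof.
move=> /mem_set yI; rewrite [RHS]integral_mkcond; apply: eq_integral => x _.
by rewrite patch_square1 !patchE yI.
Qed.

Lemma integral_square2 (F : R * R -> \bar R) :
  measurable_fun Q F -> (forall w, Q w -> 0 <= F w) ->
  \int[mu2]_(w in Q) F w = \int[mu]_(y in I) \int[mu]_(x in I) F (x, y).
Proof.
move=> mF F0; rewrite integral_mkcond.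
have mP : measurable_fun setT (F \_ Q).
  by apply/(measurable_restrictT _ measurable_unit_square).
rewrite fubini_tonelli2 //; last first.
  by move=> w; rewrite patchE; case: ifPn => // /set_mem; exact: F0.
rewrite [RHS]integral_mkcond; apply: eq_integral => y _.
rewrite patchE; case: ifPn => [/set_mem|] yI; first exact: fubini_G_square.
by apply: integral0_eq => x _; rewrite patch_square1 !patchE (negbTE yI); case: ifP.
Qed.

Lemma measurable_integral_square2 (F : R * R -> \bar R) :
  measurable_fun Q F -> (forall w, Q w -> 0 <= F w) ->
  measurable_fun I (fun y => \int[mu]_(x in I) F (x, y)).
Proof.
move=> mF F0; have mP : measurable_fun setT (F \_ Q).
  by apply/(measurable_restrictT _ measurable_unit_square).
apply: (eq_measurable_fun (fubini_G mu (F \_ Q))).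
  by move=> y /set_mem; exact: fubini_G_square.
apply: measurable_funTS; apply: measurable_fun_fubini_tonelli_G => //.
by move=> w; rewrite patchE; case: ifPn => // /set_mem; exact: F0.
Qed.

Lemma measurable_section1 (F : R * R -> \bar R) x : I x ->
  measurable_fun Q F -> measurable_fun I (fun y => F (x, y)).
Proof.
move=> xI mF; apply: (measurable_comp (F := Q)) => //.
- exact: measurable_unit_square.
- by move=> _ [y yI <-].
- apply: measurable_funTS; exact: pair1_measurable.
Qed.

Lemma measurable_section2 (F : R * R -> \bar R) y : I y ->
  measurable_fun Q F -> measurable_fun I (fun x => F (x, y)).
Proof.
move=> yI mF; apply: (measurable_comp (F := Q)) => //.
- exact: measurable_unit_square.
- by move=> _ [x xI <-].
- apply: measurable_funTS; exact: pair2_measurable.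
Qed.

Definition measure_preserving (T : R * R -> R * R) :=
  [/\ measurable_fun [set: R * R] T, (forall w, Q w -> Q (T w)) &
   forall F : R * R -> \bar R,
     measurable_fun Q F -> (forall w, Q w -> 0 <= F w) ->
     \int[mu2]_(w in Q) F (T w) = \int[mu2]_(w in Q) F w].

Lemma measurable_on_square_comp d (Y : measurableType d) (T : R * R -> R * R)
    (F : R * R -> Y) :
  measurable_fun [set: R * R] T -> (forall w, Q w -> Q (T w)) ->
  measurable_fun Q F -> measurable_fun Q (F \o T).
Proof.
move=> mT QT mF; apply: (measurable_comp (F := Q)) => //.
- exact: measurable_unit_square.
- by move=> _ [w wQ <-]; exact: QT.
- exact: measurable_funTS.
Qed.

Lemma measure_preserving_comp S T :
  measure_preserving S -> measure_preserving T -> measure_preserving (S \o T).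
Proof.
move=> [mS QS iS] [mT QT iT]; split.
- exact: measurableT_comp.
- by move=> w /QT/QS.
- move=> F mF F0; transitivity (\int[mu2]_(w in Q) (F \o S) w); last exact: iS.
  by apply: iT; [exact: measurable_on_square_comp|move=> w /QS/F0].
Qed.

Lemma measure_preserving_iter T n :
  measure_preserving T -> measure_preserving (iter n T).
Proof.
move=> hT; elim: n => [|n IH]; first by split=> //=; exact: measurable_id.
exact: (measure_preserving_comp hT IH).
Qed.

Lemma measure_preserving_eq S T : measurable_fun [set: R * R] T ->
  (forall w, Q w -> S w = T w) -> measure_preserving S -> measure_preserving T.
Proof.
move=> mT ST [_ QS iS]; split=> //.
- by move=> w wQ; rewrite -ST //; exact: QS.
- move=> F mF F0; rewrite -(iS F) //; apply: eq_integral => w /set_mem wQ.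
  by rewrite ST.
Qed.

Lemma measurable_lin (a b : R) :
  measurable_fun [set: R * R] (fun w : R * R => a * w.1 + b * w.2)%R.
Proof.
apply: measurable_funD; apply: measurable_funM.
- exact: measurable_cst.
- exact: measurable_fst.
- exact: measurable_cst.
- exact: measurable_snd.
Qed.

(** On each vertical fibre the shear is a rotation by [r * x]. Integers [r] give elementary
    matrices; [u_2 / u_1] gives coordinates along the leaves. *)
Lemma measure_preserving_shear1 (r : R) :
  measure_preserving (fun w => (w.1, frac (w.2 + r * w.1)%R)).
Proof.
have mT : measurable_fun [set: R * R] (fun w : R * R => (w.1, frac (w.2 + r * w.1)%R)).
  apply: measurable_fun_pair; first exact: measurable_fst.
  apply: measurableT_comp; first exact: measurable_frac.
  by under eq_fun do rewrite addrC -[X in (_ + X)%R]mul1r; exact: measurable_lin.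
have QT (w : R * R) : Q w -> Q (w.1, frac (w.2 + r * w.1)%R).
  by case=> wI _; split => //=; rewrite in_itv /= frac_itv.
split=> // F mF F0.
rewrite !integral_square1 //; last 2 first.
- exact: (measurable_on_square_comp mT QT mF).
- by move=> w /QT/F0.
apply: eq_integral => x /set_mem xI /=.
rewrite (@integral_frac_shift (r * x) (fun y => F (x, y))) //.
- exact: measurable_section1.
- by move=> y yI; exact: F0.
Qed.

Lemma measure_preserving_shear2 (r : R) :
  measure_preserving (fun w => (frac (w.1 + r * w.2)%R, w.2)).
Proof.
have mT : measurable_fun [set: R * R] (fun w : R * R => (frac (w.1 + r * w.2)%R, w.2)).
  apply: measurable_fun_pair; last exact: measurable_snd.
  apply: measurableT_comp; first exact: measurable_frac.
  by under eq_fun do rewrite -[X in (X + _)%R]mul1r; exact: measurable_lin.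
have QT (w : R * R) : Q w -> Q (frac (w.1 + r * w.2)%R, w.2).
  by case=> _ wI; split => //=; rewrite in_itv /= frac_itv.
split=> // F mF F0.
rewrite !integral_square2 //; last 2 first.
- exact: (measurable_on_square_comp mT QT mF).
- by move=> w /QT/F0.
apply: eq_integral => y /set_mem yI /=.
rewrite (@integral_frac_shift (r * y) (fun x => F (x, y))) //.
- exact: measurable_section2.
- by move=> x xI; exact: F0.
Qed.

End MeasurePreserving.

(** * The operator norm of 2x2 matrices and the cocycle *)

Lemma ord2E (i : 'I_2) : i = 0 \/ i = 1.
Proof. by case: i => [[|[|]]] // p; [left|right]; apply: val_inj. Qed.

Lemma mulmx2E (R : nzRingType) m (A : 'M[R]_2) (C : 'M[R]_(2, m)) i j :
  (A *m C) i j = A i 0 * C 0 j + A i 1 * C 1 j.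
Proof. by rewrite mxE big_ord_recl big_ord1 (_ : lift _ _ = 1) //; apply: val_inj. Qed.

Lemma det2E (R : comNzRingType) (A : 'M[R]_2) :
  \det A = A 0 0 * A 1 1 - A 0 1 * A 1 0.
Proof.
rewrite (expand_det_row _ 0) big_ord_recl big_ord1 /cofactor !det_mx11 !mxE /=.
rewrite addn0 addn1 expr0 expr1 mul1r mulN1r mulrN.
by congr (_ * A _ _ - A _ _ * A _ _); apply: val_inj.
Qed.

Section OperatorNorm.
Variable R : realType.
Implicit Types (A B : 'M[R]_2) (x : 'cV[R]_2).

(* [A^T A = [[P + Q, S], [S, P - Q]]], whose larger eigenvalue is
   [P + sqrt (Q^2 + S^2)]. *)
Definition gram_mean A := (A 0 0 ^+ 2 + A 0 1 ^+ 2 + A 1 0 ^+ 2 + A 1 1 ^+ 2) / 2.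
Definition gram_diff A := (A 0 0 ^+ 2 + A 1 0 ^+ 2 - A 0 1 ^+ 2 - A 1 1 ^+ 2) / 2.
Definition gram_off A := A 0 0 * A 0 1 + A 1 0 * A 1 1.
Definition gram_gap A := Num.sqrt (gram_diff A ^+ 2 + gram_off A ^+ 2).

Lemma gram_gap_ge0 A : 0 <= gram_gap A. Proof. exact: sqrtr_ge0. Qed.

Lemma gram_gap2 A : gram_gap A ^+ 2 = gram_diff A ^+ 2 + gram_off A ^+ 2.
Proof. by rewrite sqr_sqrtr // addr_ge0 ?sqr_ge0. Qed.

Lemma gram_mean_ge0 A : 0 <= gram_mean A.
Proof. by rewrite /gram_mean divr_ge0 // !addr_ge0 ?sqr_ge0. Qed.

Lemma gram_sqrt2 A : Num.sqrt (gram_mean A + gram_gap A) ^+ 2 = gram_mean A + gram_gap A.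
Proof. by rewrite sqr_sqrtr // addr_ge0 ?gram_mean_ge0 ?gram_gap_ge0. Qed.

Lemma enorm_ge0 x : 0 <= enorm x. Proof. exact: sqrtr_ge0. Qed.

Lemma enorm2 x : enorm x ^+ 2 = x 0 0 ^+ 2 + x 1 0 ^+ 2.
Proof. by rewrite sqr_sqrtr // addr_ge0 ?sqr_ge0. Qed.

Lemma enormZ (k : R) x : enorm (k *: x) = `|k| * enorm x.
Proof. by rewrite /enorm !mxE !exprMn -mulrDr sqrtrM ?sqr_ge0 // sqrtr_sqr. Qed.

Lemma enorm2_mulmx A x : enorm (A *m x) ^+ 2 =
  gram_mean A * enorm x ^+ 2 +
  (gram_diff A * (x 0 0 ^+ 2 - x 1 0 ^+ 2) + gram_off A * (2 * x 0 0 * x 1 0)).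
Proof.
rewrite !enorm2 !mulmx2E /gram_mean /gram_diff /gram_off; by field.
Qed.

(** Cauchy-Schwarz for [(gram_diff A, gram_off A)] against [(x_1^2 - x_2^2, 2 x_1 x_2)], a vector of
    length [|x|^2]. *)
Lemma enorm_mulmx_sqrt A x :
  enorm (A *m x) <= Num.sqrt (gram_mean A + gram_gap A) * enorm x.
Proof.
rewrite -(@ler_pXn2r _ 2) ?nnegrE ?normr_ge0 ?mulr_ge0 ?sqrtr_ge0 ?enorm_ge0 //.
rewrite exprMn gram_sqrt2.
rewrite enorm2_mulmx [leRHS]mulrDl lerD2l; apply: le_trans (ler_norm _) _.
rewrite -(@ler_pXn2r _ 2) ?nnegrE ?normr_ge0 ?mulr_ge0 ?sqr_ge0 ?gram_gap_ge0 ?enorm_ge0 //.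
rewrite exprMn gram_gap2 real_normK ?num_real // enorm2.
rewrite -subr_ge0 [X in 0 <= X](_ : _ = (gram_diff A * (2 * x 0 0 * x 1 0)
   - gram_off A * (x 0 0 ^+ 2 - x 1 0 ^+ 2)) ^+ 2); last by ring.
exact: sqr_ge0.
Qed.

(** The maximiser is a normalised eigenvector of the traceless part [[[q, s], [s, -q]]] of [A^T A]
    for its eigenvalue [r = gram_gap A]. *)
Lemma enorm_mulmx_attained A : exists2 x, enorm x = 1 &
  enorm (A *m x) = Num.sqrt (gram_mean A + gram_gap A).
Proof.
suff [x x0 hx] : exists2 x, 0 < enorm x &
    gram_diff A * (x 0 0 ^+ 2 - x 1 0 ^+ 2) + gram_off A * (2 * x 0 0 * x 1 0)
    = gram_gap A * enorm x ^+ 2.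
  have hA : enorm (A *m x) = Num.sqrt (gram_mean A + gram_gap A) * enorm x.
    apply/eqP; rewrite -(@eqrXn2 _ 2) ?mulr_ge0 ?sqrtr_ge0 ?enorm_ge0 //.
    by rewrite enorm2_mulmx hx exprMn gram_sqrt2 mulrDl.
  exists ((enorm x)^-1 *: x).
    by rewrite enormZ ger0_norm ?invr_ge0 ?ltW // mulVf // gt_eqF.
  rewrite -scalemxAr enormZ ger0_norm ?invr_ge0 ?(ltW x0) // hA.
  by rewrite mulrCA mulVf ?mulr1 // gt_eqF.
have h2 := gram_gap2 A; have h0 := gram_gap_ge0 A.
have hq : 0 <= gram_gap A + gram_diff A.
  rewrite -lerBlDr sub0r; apply: le_trans (ler_norm _) _; rewrite normrN.
  by rewrite -(@ler_pXn2r _ 2) ?nnegrE ?normr_ge0 // real_normK ?num_real // h2 lerDl sqr_ge0.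
move: h2 h0 hq; move: (gram_gap A) (gram_diff A) (gram_off A) => r q s h2 h0 hq.
(* If [r + q = 0] the traceless part is [diag(-r, r)] and the second basis vector works; otherwise
   [(r + q, s)] is a nonzero eigenvector. *)
have [q0|q0] := eqVneq (r + q) 0.
  have s0 : s = 0 by apply/eqP; rewrite -sqrf_eq0; apply/eqP; nra.
  exists (\col_i (i == 1)%:R).
    by rewrite /enorm !mxE /= expr0n expr1n add0r sqrtr1.
  by rewrite enorm2 !mxE /= s0; nra.
exists (\col_i (if i == 0 then r + q else s)).
  rewrite sqrtr_gt0 !mxE /= ltr_pwDl ?sqr_ge0 // lt_neqAle sqr_ge0 andbT.
  by rewrite eq_sym sqrf_eq0.
rewrite enorm2 !mxE /=.
have -> : s ^+ 2 = r ^+ 2 - q ^+ 2 by rewrite h2; ring.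
rewrite [LHS](_ : _ = q * ((r + q) ^+ 2 - (r ^+ 2 - q ^+ 2)) +
  s ^+ 2 * (2 * (r + q))); last by ring.
have -> : s ^+ 2 = r ^+ 2 - q ^+ 2 by rewrite h2; ring.
by ring.
Qed.

Lemma opnormE A : opnorm A = Num.sqrt (gram_mean A + gram_gap A).
Proof.
have ub : ubound [set enorm (A *m x) | x in [set x | enorm x = 1]]
    (Num.sqrt (gram_mean A + gram_gap A)).
  by move=> _ [x /= x1 <-]; have := enorm_mulmx_sqrt A x; rewrite x1 mulr1.
have [x x1 hx] := enorm_mulmx_attained A.
apply: le_anti; apply/andP; split.
  by apply: ge_sup => //; exists (enorm (A *m x)); exists x.
apply: ub_le_sup; first by eexists; exact: ub.
by exists x.
Qed.

Lemma opnorm_ge0 A : 0 <= opnorm A. Proof. by rewrite opnormE sqrtr_ge0. Qed.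

Lemma opnorm2 A : opnorm A ^+ 2 = gram_mean A + gram_gap A.
Proof. by rewrite opnormE gram_sqrt2. Qed.

Lemma enorm_mulmx_le A x : enorm (A *m x) <= opnorm A * enorm x.
Proof. by rewrite opnormE; exact: enorm_mulmx_sqrt. Qed.

Lemma opnormM A B : opnorm (A *m B) <= opnorm A * opnorm B.
Proof.
have [x x1 hx] := enorm_mulmx_attained (A *m B).
rewrite [leLHS]opnormE -hx -mulmxA; apply: le_trans (enorm_mulmx_le _ _) _.
rewrite ler_wpM2l ?opnorm_ge0 //.
by have := enorm_mulmx_le B x; rewrite x1 mulr1.
Qed.

(** The identity [gram_mean^2 = gram_diff^2 + gram_off^2 + det^2] yields [1 <= gram_mean]. *)
Lemma opnorm_ge1 A : \det A = 1 -> 1 <= opnorm A.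
Proof.
rewrite det2E => dA.
rewrite -(@ler_pXn2r _ 2) ?nnegrE ?normr_ge0 ?opnorm_ge0 // expr1n opnorm2.
suff : 1 <= gram_mean A by have := gram_gap_ge0 A; lra.
rewrite -(@ler_pXn2r _ 2) ?nnegrE ?normr_ge0 ?gram_mean_ge0 // expr1n.
have -> : gram_mean A ^+ 2 = gram_diff A ^+ 2 + gram_off A ^+ 2 +
   (A 0 0 * A 1 1 - A 0 1 * A 1 0) ^+ 2.
  by rewrite /gram_mean /gram_diff /gram_off; field.
by rewrite dA expr1n lerDr addr_ge0 ?sqr_ge0.
Qed.

(** [gram_mean + gram_diff] is the squared length of the first column, and
    [gram_diff <= gram_gap]. *)
Lemma opnorm_ge_entry A : `|A 0 0| <= opnorm A.
Proof.
rewrite -(@ler_pXn2r _ 2) ?nnegrE ?normr_ge0 ?opnorm_ge0 // real_normK ?num_real // opnorm2.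
have : gram_diff A <= gram_gap A.
  apply: le_trans (ler_norm _) _.
  rewrite -(@ler_pXn2r _ 2) ?nnegrE ?normr_ge0 ?gram_gap_ge0 // real_normK ?num_real //.
  by rewrite gram_gap2 lerDl sqr_ge0.
have := sqr_ge0 (A 1 0); rewrite /gram_diff /gram_mean; lra.
Qed.

Lemma opnorm_le_frobenius A : opnorm A ^+ 2 <= 2 * gram_mean A.
Proof.
rewrite opnorm2; suff : gram_gap A <= gram_mean A by lra.
rewrite -(@ler_pXn2r _ 2) ?nnegrE ?normr_ge0 ?gram_mean_ge0 ?gram_gap_ge0 // gram_gap2.
rewrite -subr_ge0 [X in 0 <= X](_ : _ = (A 0 0 * A 1 1 - A 0 1 * A 1 0) ^+ 2) ?sqr_ge0 //.
by rewrite /gram_mean /gram_diff /gram_off; field.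
Qed.

Lemma measurable_sqrt : measurable_fun [set: R] (@Num.sqrt R).
Proof.
apply: nondecreasing_measurable => // x y xy; exact: ler_wsqrtr.
Qed.

Lemma measurable_opnorm d (T : measurableType d) (D : set T) (A : T -> 'M[R]_2) :
  measurable D -> (forall i j, measurable_fun D (fun w => A w i j)) ->
  measurable_fun D (fun w => opnorm (A w)).
Proof.
move=> mD mA; under eq_fun do rewrite opnormE.
have m2 i j : measurable_fun D (fun w => A w i j ^+ 2) by exact: measurable_funX.
have mh (f : T -> R) : measurable_fun D f -> measurable_fun D (fun w => f w / 2).
  by move=> mf; apply: measurable_funM.
apply: (measurableT_comp measurable_sqrt); apply: measurable_funD.
  by apply: mh; do 3!apply: measurable_funD => //.
apply: (measurableT_comp measurable_sqrt).
apply: measurable_funD; apply: measurable_funX.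
  by apply: mh; do 2!apply: measurable_funB => //; apply: measurable_funD.
by apply: measurable_funD; apply: measurable_funM.
Qed.

End OperatorNorm.

(** * The Schrodinger cocycle: determinant, cocycle identity, first column *)

Section Cocycle.
Variables (R : realType) (M : 'M[int]_2) (E lambda : R) (v : R * R -> R).
Local Notation T := (toral_map M).
Local Notation A := (cocycle M E lambda v).

Lemma schrodinger_mxE w :
  [/\ schrodinger_mx E lambda v w 0 0 = E - lambda * v w,
      schrodinger_mx E lambda v w 0 1 = -1,
      schrodinger_mx E lambda v w 1 0 = 1 &
      schrodinger_mx E lambda v w 1 1 = 0].
Proof. by rewrite !mxE. Qed.

Lemma det_cocycle n w : \det (A n w) = 1.
Proof.
elim: n => [|n IH] /=; first exact: det1.
rewrite det_mulmx IH mulr1 det2E.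
by have [-> -> -> ->] := schrodinger_mxE (iter n T w); ring.
Qed.

Lemma cocycleD m n w : A (m + n)%N w = A m (iter n T w) *m A n w.
Proof.
elim: m => [|m IH] /=; first by rewrite mul1mx.
by rewrite IH iterD mulmxA.
Qed.

Lemma cocycleS00 n w :
  A n.+1 w 0 0 = (E - lambda * v (iter n T w)) * A n w 0 0 - A n w 1 0.
Proof. by rewrite mulmx2E; have [-> -> _ _] := schrodinger_mxE (iter n T w); rewrite mulN1r. Qed.

Lemma cocycleS10 n w : A n.+1 w 1 0 = A n w 0 0.
Proof. by rewrite mulmx2E; have [_ _ -> ->] := schrodinger_mxE (iter n T w); rewrite mul1r mul0r addr0. Qed.

End Cocycle.

(** * Toral automorphisms and their unstable leaves *)

Section ToralMaps.
Variable R : realType.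
Implicit Types (M N : 'M[int]_2).
Local Notation Q := (unit_square R).

Definition mx2 (a b c d : int) : 'M[int]_2 :=
  \matrix_(i, j) if i == 0 then if j == 0 then a else b
                 else if j == 0 then c else d.

Lemma mx2E M : M = mx2 (M 0 0) (M 0 1) (M 1 0) (M 1 1).
Proof.
by apply/matrixP => i j; have [->|->] := ord2E i; have [->|->] := ord2E j; rewrite !mxE.
Qed.

Lemma mul_mx2 a b c d a' b' c' d' : mx2 a b c d *m mx2 a' b' c' d' =
  mx2 (a * a' + b * c') (a * b' + b * d') (c * a' + d * c') (c * b' + d * d').
Proof.
by apply/matrixP => i j; have [->|->] := ord2E i; have [->|->] := ord2E j;
  rewrite mulmx2E !mxE.
Qed.

Lemma det_mx2 a b c d : \det (mx2 a b c d) = a * d - b * c.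
Proof. by rewrite det2E !mxE. Qed.

Lemma toral_mapE M (w : R * R) : toral_map M w =
  (frac ((M 0 0)%:~R * w.1 + (M 0 1)%:~R * w.2),
   frac ((M 1 0)%:~R * w.1 + (M 1 1)%:~R * w.2)).
Proof. by rewrite /toral_map !mxE. Qed.

Lemma frac_lin (a b : int) (x y : R) :
  frac (a%:~R * frac x + b%:~R * frac y) = frac (a%:~R * x + b%:~R * y).
Proof.
apply: frac_eqP; rewrite opprD addrACA -!mulrBr.
by apply: rpredD; apply: rpredM; rewrite ?intr_int ?frac_sub.
Qed.

Lemma toral_map_mulmx M N (w : R * R) :
  toral_map (M *m N) w = toral_map M (toral_map N w).
Proof.
rewrite !toral_mapE /= !frac_lin !mulmx2E.
by congr (frac _, frac _); rewrite !intrD !intrM; ring.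
Qed.

Lemma measurable_toral_map M : measurable_fun [set: R * R] (toral_map M).
Proof.
rewrite (funext (toral_mapE M)).
apply: measurable_fun_pair; apply: (measurableT_comp (@measurable_frac R)).
  exact: measurable_lin.
exact: measurable_lin.
Qed.

Local Notation preserves M := (measure_preserving (@toral_map R M)).

Lemma preserves_mulmx M N : preserves M -> preserves N -> preserves (M *m N).
Proof.
move=> hM hN; apply: measure_preserving_eq (measure_preserving_comp hM hN).
  exact: measurable_toral_map.
by move=> w _; rewrite toral_map_mulmx.
Qed.

Lemma preserves_upper (k : int) : preserves (mx2 1 k 0 1).
Proof.
apply: measure_preserving_eq (measure_preserving_shear2 k%:~R).
  exact: measurable_toral_map.
move=> [x y] [/= _]; rewrite in_itv /= => yI.
by rewrite toral_mapE !mxE /= !mul1r mul0r add0r (frac_id yI).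
Qed.

Lemma preserves_lower (k : int) : preserves (mx2 1 0 k 1).
Proof.
apply: measure_preserving_eq (measure_preserving_shear1 k%:~R).
  exact: measurable_toral_map.
move=> [x y] [/=]; rewrite in_itv /= => xI _.
by rewrite toral_mapE !mxE /= !mul1r mul0r addr0 (frac_id xI) addrC.
Qed.

Lemma preserves_rot : preserves (mx2 0 (-1) 1 0).
Proof.
have -> : mx2 0 (-1) 1 0 = mx2 1 (-1) 0 1 *m mx2 1 0 1 1 *m mx2 1 (-1) 0 1.
  by rewrite !mul_mx2.
by do 2?apply: preserves_mulmx; [exact: preserves_upper|exact: preserves_lower|exact: preserves_upper].
Qed.

(* Euclid's algorithm on the first column writes [M] as a product of shears. *)
Lemma toral_map_preserving M : \det M = 1 -> preserves M.
Proof.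
move: {2}(absz (M 1 0)).+1 (ltnSn (absz (M 1 0))) => n.
elim: n M => // n IH M; rewrite (mx2E M) det_mx2 mxE /=.
move: (M 0 0) (M 0 1) (M 1 0) (M 1 1) => a b c d cn dM.
have [c0|c0] := eqVneq c 0.
  move: dM; rewrite c0 mulr0 subr0 => ad.
  have [[-> ->]|[-> ->]] : (a = 1 /\ d = 1) \/ (a = -1 /\ d = -1).
  - have /eqP := congr1 absz ad; rewrite abszM muln_eq1 => /andP[/eqP a1 _].
    have [ea|ea] : a = 1 \/ a = -1 by lia.
      by left; move: ad; rewrite ea mul1r.
    by right; split=> //; move: ad; rewrite ea mulN1r; lia.
  - exact: preserves_upper.
  - have -> : mx2 (-1) b 0 (-1) =
        mx2 0 (-1) 1 0 *m mx2 0 (-1) 1 0 *m mx2 1 (- b) 0 1.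
      by rewrite !mul_mx2; congr mx2; ring.
    by do 2?apply: preserves_mulmx; [exact: preserves_rot|exact: preserves_rot|exact: preserves_upper].
pose q := (a %/ c)%Z; pose r := (a %% c)%Z.
have ea : a = q * c + r by exact: divz_eq.
(* Subtracting [q] times the second row from the first leaves [r] above [c]; a quarter turn brings
   [-r] to the lower left, with [|r| < |c|]. *)
have -> : mx2 a b c d = mx2 1 q 0 1 *m mx2 0 (-1) 1 0 *m
    mx2 c d (- r) (q * d - b).
  by rewrite !mul_mx2 {1}ea; congr mx2; ring.
apply: preserves_mulmx.
  by apply: preserves_mulmx; [exact: preserves_upper|exact: preserves_rot].
apply: IH; last by rewrite det_mx2 -dM ea; ring.
rewrite mxE /=.
have r0 : 0 <= r by exact: modz_ge0.
have rc : r < `|c| by exact: ltz_mod.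
lia.
Qed.

End ToralMaps.

(** * Eigenvector, expansion rate and unstable leaves of the toral automorphism *)

Section Hyperbolic.
Variables (R : realType) (M : 'M[int]_2) (beta : R) (u : 'cV[R]_2).
Hypothesis detM : \det M = 1.
Hypothesis beta_gt1 : 1 < beta.
Hypothesis u_neq0 : u != 0.
Hypothesis u_eigen : mx_real R M *m u = beta *: u.
Local Notation a := ((M 0 0)%:~R : R).
Local Notation b := ((M 0 1)%:~R : R).
Local Notation c := ((M 1 0)%:~R : R).
Local Notation d := ((M 1 1)%:~R : R).

Lemma eigen_row0 : a * u 0 0 + b * u 1 0 = beta * u 0 0.
Proof. by have /matrixP/(_ 0 0) := u_eigen; rewrite mulmx2E !mxE. Qed.

Lemma eigen_row1 : c * u 0 0 + d * u 1 0 = beta * u 1 0.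
Proof. by have /matrixP/(_ 1 0) := u_eigen; rewrite mulmx2E !mxE. Qed.

Lemma det_real : a * d - b * c = 1.
Proof. by rewrite -!intrM -intrB -det2E detM. Qed.

Lemma nonunit_entries (m n : int) : m%:~R = beta -> m * n != 1.
Proof.
move=> e; apply/eqP => mn1.
have m1 : 1 < m by rewrite -(ltr_int R) e.
have /eqP := congr1 absz mn1; rewrite abszM muln_eq1 => /andP[/eqP]; lia.
Qed.

(** A vanishing coordinate would make [M] triangular with [beta] on the diagonal; then [beta] would
    be an integer larger than 1 dividing the determinant 1. *)
Lemma eigenvector_coords : u 0 0 != 0 /\ u 1 0 != 0.
Proof.
have E0 := eigen_row0; have E1 := eigen_row1; have D : M 0 0 * M 1 1 - M 0 1 * M 1 0 = 1.
  by rewrite -det2E.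
have nz : (u 0 0 != 0) || (u 1 0 != 0).
  rewrite -negb_and; apply: contra u_neq0 => /andP[/eqP h0 /eqP h1].
  apply/eqP/matrixP => i j; rewrite mxE (ord1 j).
  by have [->|->] := ord2E i.
split; apply/eqP => h; move: nz E0 E1; rewrite h eqxx /= ?orbF => nz.
- rewrite !mulr0 !add0r => /eqP; rewrite mulf_eq0 (negbTE nz) orbF intr_eq0 => /eqP b0.
  move=> /(mulIf nz) e; move: D; rewrite b0 mul0r subr0 mulrC => /eqP.
  by apply/negP; exact: nonunit_entries.
- rewrite !mulr0 !addr0 => /(mulIf nz) e /eqP.
  rewrite mulf_eq0 (negbTE nz) orbF intr_eq0 => /eqP c0.
  by move: D; rewrite c0 mulr0 subr0 => /eqP; apply/negP; exact: nonunit_entries.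
Qed.

(* [beta + 1/beta] is an integer larger than 2, hence at least 3. *)
Lemma beta_gt2 : 2 < beta.
Proof.
have [u0 _] := eigenvector_coords.
have E0 := eigen_row0; have E1 := eigen_row1; have D := det_real.
have char : beta ^+ 2 - (a + d) * beta + 1 = 0.
  apply: (mulIf u0); rewrite mul0r.
  move: D E0 E1; move: a b c d (u 0 0) (u 1 0) => p q s t x y D E0 E1.
  rewrite [LHS](_ : _ = (p * x + q * y - beta * x) * (t - beta)
     - q * (s * x + t * y - beta * y) + (1 - (p * t - q * s)) * x); last by ring.
  by rewrite E0 E1 D !subrr !mul0r mulr0 subr0 addr0.
have t2 : 2 < M 0 0 + M 1 1.
  have b0 : 0 < beta := lt_trans ltr01 beta_gt1.
  have : 0 < (beta - 1) ^+ 2 by rewrite exprn_gt0 // subr_gt0.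
  rewrite -(ltr_int R) intrD (_ : 2%:~R = 2 :> R) //.
  by rewrite -(@ltr_pM2r _ beta) //; move: char; move: a d => p s char h; nra.
have : (3%:~R : R) <= a + d by rewrite -intrD ler_int; lia.
move: char; move: a d => p s char; rewrite (_ : 3%:~R = 3 :> R) // => t3.
(* For [1 < beta <= 2], [(beta - 1) * (beta - 2) <= 0] gives [beta^2 + 1 < 3 * beta], against
   [beta^2 + 1 = (p + s) * beta] with trace [p + s >= 3]. *)
by rewrite ltNge; apply/negP => b2; have b1 := beta_gt1; nra.
Qed.

(** Each step multiplies the direction [(1, r)] by [beta], and [frac_lin] absorbs the inner
    fractional parts. The base point [(p, q)] is independent of [x], so the image is an affine path
    modulo 1. *)
Lemma leaf_iter (y : R) (k : nat) : exists p q : R, forall x, 0 <= x < 1 ->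
  iter k (toral_map M) (x, frac (y + u 1 0 / u 0 0 * x)) =
  (frac (p + beta ^+ k * x), frac (q + beta ^+ k * (u 1 0 / u 0 0) * x)).
Proof.
have [u0 _] := eigenvector_coords; set r := _ / _.
have hr : r * u 0 0 = u 1 0 by rewrite /r divfK.
clearbody r.
have E0 : a + b * r = beta.
  by apply: (mulIf u0); rewrite mulrDl -!mulrA hr eigen_row0.
have E1 : c + d * r = beta * r.
  by apply: (mulIf u0); rewrite mulrDl -!mulrA hr eigen_row1.
elim: k => [|k [p [q IH]]].
  by exists 0, y => x x01; rewrite /= expr0 add0r !mul1r (frac_id x01).
exists (a * p + b * q), (c * p + d * q) => x x01.
rewrite iterS IH // toral_mapE /= !frac_lin exprS; congr (frac _, frac _).
  transitivity (a * p + b * q + (a + b * r) * beta ^+ k * x); first by ring.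
  by rewrite E0.
transitivity (c * p + d * q + (c + d * r) * beta ^+ k * x); first by ring.
by rewrite E1; ring.
Qed.

End Hyperbolic.

(** * Integer values of affine functions, where their fractional parts jump *)

Section IntegerCrossings.
Variable R : realType.

Lemma int_crossings (p s : R) : s != 0 -> exists2 S : seq R,
  (size S)%:R <= `|s| + 2 &
  forall x, 0 <= x <= 1 -> p + s * x \is a Num.int -> x \in S.
Proof.
(* The values on [[0, 1]] fill an interval of length [|s|] starting at [m]. An integer in it exceeds
   [floor m] by less than [|s| + 1], so [N] candidates suffice. *)
move=> s0; pose m := Num.min p (p + s); pose N := (Num.truncn `|s|).+2.
exists [seq ((Num.floor m)%:~R + i%:R - p) / s | i <- iota 0 N].
  rewrite size_map size_iota /N -addn2 natrD lerD2r.
  by have /andP[] := truncn_itv (normr_ge0 s).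
move=> x x01 /intrP[j ej].
have jm : m <= j%:~R <= m + `|s|.
  rewrite -ej /m; have [s0'|s0'] := leP 0 s.
    by rewrite (min_idPl _) ?lerDl // ger0_norm //; nra.
  rewrite (min_idPr _); last by lra.
  by rewrite ltr0_norm //; nra.
have fm := floor_itv m; rewrite intrD in fm.
have jf : Num.floor m <= j by rewrite -(ler_int R); lra.
have [i ei] : exists i : nat, j = Num.floor m + i%:Z.
  by exists `|j - Num.floor m|%N; lia.
apply/mapP; exists i; last first.
  rewrite (_ : (Num.floor m)%:~R + i%:R = j%:~R); last by rewrite ei intrD.
  by rewrite -ej [p + _]addrC addrK mulrAC divff // mul1r.
rewrite mem_iota /= add0n /N -(ltr_nat R) -natr1 -natr1.
have /andP[_] := truncn_itv (normr_ge0 s); rewrite -natr1.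
have : (j%:~R : R) = (Num.floor m)%:~R + i%:R by rewrite ei intrD.
lra.
Qed.

Lemma floor_const (p s x y : R) : x <= y ->
  (forall t, x <= t <= y -> p + s * t \isn't a Num.int) ->
  Num.floor (p + s * x) = Num.floor (p + s * y).
Proof.
move=> xy ni; apply/eqP/negPn/negP => ne.
set P := p + s * x in ne *; set Q := p + s * y in ne *.
have [n hn] : exists n : int, (P < n%:~R <= Q) || (Q < n%:~R <= P).
  have := floor_itv P; have := floor_itv Q; rewrite !intrD => hQ hP.
  case: (ltgtP (Num.floor P) (Num.floor Q)) ne => // lt _.
    exists (Num.floor Q); apply/orP; left.
    have : (Num.floor P + 1)%:~R <= ((Num.floor Q)%:~R : R) by rewrite ler_int; lia.
    by rewrite intrD; lra.
  exists (Num.floor P); apply/orP; right.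
  have : (Num.floor Q + 1)%:~R <= ((Num.floor P)%:~R : R) by rewrite ler_int; lia.
  by rewrite intrD; lra.
(* The parameter at which the affine function takes the integer value [n] between its end values. *)
pose th := (n%:~R - P) / (Q - P).
have PQ : Q - P != 0 by rewrite subr_eq0; apply/eqP => e; move: hn; rewrite e; lra.
have th01 : 0 <= th <= 1.
  have e : th * (Q - P) = n%:~R - P by rewrite /th divfK.
  case/orP: hn => h; nra.
have := ni (x + th * (y - x)).
rewrite (_ : p + _ = n%:~R) ?intr_int; last first.
  have -> : p + s * (x + th * (y - x)) = P + th * (Q - P) by rewrite /P /Q; ring.
  by rewrite /th divfK // addrC subrK.
by move=> /(_ _)/negP; apply=> //; apply/andP; nra.
Qed.

(** Without integer values the floor is constant and the fractional part never vanishes. The strict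
    bounds will place paths in the open square, where derivatives are two-sided. *)
Lemma frac_affine (p s x y : R) : x <= y ->
  (forall t, x <= t <= y -> p + s * t \isn't a Num.int) ->
  exists p', forall t, x <= t <= y ->
    frac (p + s * t) = p' + s * t /\ 0 < p' + s * t < 1.
Proof.
move=> xy ni; exists (p - (Num.floor (p + s * x))%:~R) => t /[dup] xty /andP[xt ty].
have -> : Num.floor (p + s * x) = Num.floor (p + s * t).
  by apply: floor_const => // z /andP[xz zt]; apply: ni; rewrite xz (le_trans zt).
have e : frac (p + s * t) = p - (Num.floor (p + s * t))%:~R + s * t.
  by rewrite /frac addrAC.
split=> //; rewrite -e; have /andP[h0 ->] := frac_itv (p + s * t).
rewrite andbT lt_neqAle h0 andbT eq_sym; apply: contra (ni _ xty) => /eqP f0.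
by have := frac_sub (p + s * t); rewrite f0 sub0r rpredN.
Qed.

End IntegerCrossings.

(** * Differentiation along segments in the open square *)

Section InteriorDerivative.
Variables (R : realType) (v : R * R -> R).
Hypothesis v_C1 : C1_square v.

Definition open_square (w : R * R) := 0 < w.1 < 1 /\ 0 < w.2 < 1.

Lemma open_square_sub w : open_square w -> unit_square R w.
Proof.
case: w => x y [/= /andP[x0 x1] /andP[y0 y1]].
by split; rewrite /= in_itv /= ltW.
Qed.

Lemma near_affine (a b x s : R) : a < x < b ->
  \forall h \near 0, a < x + h * s < b.
Proof.
move=> /andP[ax xb].
have lim : (x + h * s) @[h --> 0] --> x.
  rewrite -[X in _ --> X]addr0 -[X in _ --> _ + X](mul0r s).
  by apply: cvgD; [exact: cvg_cst|apply: cvgM; [exact: cvg_id|exact: cvg_cst]].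
near=> h; apply/andP; split; near: h.
- exact: (cvgr_gt x).
- exact: (cvgr_lt x).
Unshelve. all: by end_near. Qed.

(** Small steps from an interior point stay in the square, so [steps e w] is the punctured
    neighbourhood filter of 0. *)
Lemma derive_sq_interior e w : open_square w -> derivable_sq v e w ->
  quotient_at v e w @ 0^' --> derive_sq v e w.
Proof.
move=> [w1 w2]; rewrite /derivable_sq /derive_sq /steps.
set D := [set h | _]; have D0 : nbhs (0 : R) D.
  near=> h; apply: open_square_sub; split; near: h; exact: near_affine.
rewrite (_ : within D 0^' = 0^') //.
rewrite eqEsubset; split => P.
  rewrite /within /= => hP; have : (0 : R)^' D by exact: nbhs_dnbhs.
  by move=> hD; apply: filterS2 hP hD => h; apply.
by rewrite /within /= => hP; apply: filterS hP => h.
Unshelve. all: by end_near. Qed.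

Lemma is_derive_sq1 (x y : R) : open_square (x, y) ->
  is_derive x 1 (fun s : R => v (s, y)) (derive_sq v (e1 R) (x, y)).
Proof.
move=> w; have [d _] := v_C1 (or_introl erefl).
have lim := derive_sq_interior w (d _ (open_square_sub w)).
suff eq : (fun h : R => h^-1 *: (((fun s => v (s, y)) \o shift x) (h *: 1) - v (x, y)))
    = quotient_at v (e1 R) (x, y).
  apply: DeriveDef; rewrite /derivable /derive eq; first by apply/cvg_ex; eexists; exact: lim.
  exact: cvg_lim.
apply/funext => h; rewrite /quotient_at /= /shift /= -[h *: 1]/(h * 1) -[_ *: _]/(_ * _).
by rewrite mulr0 addr0 [x + _]addrC.
Qed.

Lemma is_derive_sq2 (x y : R) : open_square (x, y) ->
  is_derive y 1 (fun s : R => v (x, s)) (derive_sq v (e2 R) (x, y)).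
Proof.
move=> w; have [d _] := v_C1 (or_intror erefl).
have lim := derive_sq_interior w (d _ (open_square_sub w)).
suff eq : (fun h : R => h^-1 *: (((fun s => v (x, s)) \o shift y) (h *: 1) - v (x, y)))
    = quotient_at v (e2 R) (x, y).
  apply: DeriveDef; rewrite /derivable /derive eq; first by apply/cvg_ex; eexists; exact: lim.
  exact: cvg_lim.
apply/funext => h; rewrite /quotient_at /= /shift /= -[h *: 1]/(h * 1) -[_ *: _]/(_ * _).
by rewrite mulr0 addr0 [y + _]addrC.
Qed.

Lemma derive_sq_near e w : e = e1 R \/ e = e2 R -> open_square w ->
  forall eps, 0 < eps -> exists2 delta, 0 < delta &
    forall z : R * R, `|z.1 - w.1| < delta -> `|z.2 - w.2| < delta ->
      `|derive_sq v e z - derive_sq v e w| < eps.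
Proof.
move=> he w0 eps eps0; have [_ ct] := v_C1 he.
pose O : set (R * R) := `]0, 1[ `*` `]0, 1[.
have oO : open O.
  rewrite openE => -[x y] [/= x01 y01]; rewrite /interior /=.
  exists (`]0, 1[%classic, `]0, 1[%classic) => //=.
  by split; apply: open_nbhs_nbhs; split => //; exact: interval_open.
have Ow : O w by case: w0; split; rewrite /= in_itv.
have : {within O, continuous (derive_sq v e)}.
  apply: continuous_subspaceW ct => -[x y] [/=]; rewrite !in_itv /= => x01 y01.
  exact: open_square_sub.
rewrite continuous_open_subspace // => /(_ w); rewrite inE => /(_ Ow).
move=> /cvgrPdist_lt/(_ _ eps0) /nbhs_ballP[delta /= delta0 hd].
exists delta => // z z1 z2; rewrite distrC; apply: hd; split; rewrite /ball /=.
  by rewrite distrC.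
by rewrite distrC.
Qed.

Lemma mvt_unordered (f df : R -> R) (a b : R) :
  (forall t, Num.min a b <= t <= Num.max a b -> is_derive t 1 f (df t)) ->
  exists2 c, Num.min a b <= c <= Num.max a b & f b - f a = df c * (b - a).
Proof.
wlog : a b / a <= b => [hw|ab].
  have [ab|ba] := orP (le_total a b); first exact: hw.
  rewrite minC maxC => h; have [c cba e] := hw _ _ ba h.
  by exists c => //; rewrite -opprB e -mulrN opprB.
rewrite (min_idPl ab) (max_idPr ab) => h.
have [||c] := @MVT_segment R f df a b ab.
- by move=> t; rewrite in_itv /= => /andP[/ltW at_ /ltW tb]; apply: h; rewrite at_.
- apply: derivable_within_continuous => t; rewrite in_itv /= => tab.
  by have [] := h t tab.
- by rewrite in_itv /=; exists c.
Qed.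

Lemma between_dist (a b c : R) : Num.min a b <= c <= Num.max a b -> `|c - a| <= `|b - a|.
Proof.
case/orP: (le_total a b) => ab.
  rewrite (min_idPl ab) (max_idPr ab).
  move=> /andP[h1 h2]; rewrite !ger0_norm ?subr_ge0 //; lra.
rewrite (min_idPr ab) (max_idPl ab).
by move=> /andP[h1 h2]; rewrite !ler0_norm ?subr_le0 //; lra.
Qed.

Lemma between_open (a b c : R) : 0 < a < 1 -> 0 < b < 1 ->
  Num.min a b <= c <= Num.max a b -> 0 < c < 1.
Proof.
case/orP: (le_total a b) => ab.
  by rewrite (min_idPl ab) (max_idPr ab); lra.
by rewrite (min_idPr ab) (max_idPl ab); lra.
Qed.

(** Chain rule from continuous partial derivatives: the increment is split into a horizontal and a
    vertical step, and the mean value theorem is applied to each. Either step may be negative,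
    whence [mvt_unordered]. *)
Lemma is_derive_path (x y alpha gamma t : R) :
  open_square (x + alpha * t, y + gamma * t) ->
  is_derive t 1 (fun s : R => v (x + alpha * s, y + gamma * s))
    (alpha * derive_sq v (e1 R) (x + alpha * t, y + gamma * t) +
     gamma * derive_sq v (e2 R) (x + alpha * t, y + gamma * t)).
Proof.
set w := (_, _) => w0; case: (w0) => /= w1 w2.
set A := derive_sq v (e1 R) w; set B := derive_sq v (e2 R) w.
suff lim : (h^-1 *: (((fun s : R => v (x + alpha * s, y + gamma * s)) \o shift t) (h *: 1)
      - v w)) @[h --> (0 : R)^'] --> alpha * A + gamma * B.
  apply: DeriveDef; rewrite /derivable /derive; last exact: cvg_lim lim.
  by apply/cvg_ex; eexists; exact: lim.
apply/cvgrPdist_lt => eps eps0.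
pose K := `|alpha| + `|gamma| + 1.
have K0 : 0 < K by rewrite /K; have := normr_ge0 alpha; have := normr_ge0 gamma; lra.
have eK : 0 < eps / K by rewrite divr_gt0.
have [d1 d10 h1] := derive_sq_near (or_introl erefl) w0 eK.
have [d2 d20 h2] := derive_sq_near (or_intror erefl) w0 eK.
pose d := Num.min d1 d2.
have d0 : 0 < d by rewrite lt_min d10.
near=> h.
have hn0 : h != 0 by near: h; exact: nbhs_dnbhs_neq.
have hx : 0 < w.1 + h * alpha < 1 by near: h; apply: nbhs_dnbhs; exact: near_affine.
have hy : 0 < w.2 + h * gamma < 1 by near: h; apply: nbhs_dnbhs; exact: near_affine.
have dx : - d < 0 + h * alpha < d.
  by near: h; apply: nbhs_dnbhs; apply: near_affine; rewrite oppr_lt0 d0.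
have dy : - d < 0 + h * gamma < d.
  by near: h; apply: nbhs_dnbhs; apply: near_affine; rewrite oppr_lt0 d0.
have [c1 c1b e1'] := @mvt_unordered (fun s => v (s, w.2 + h * gamma))
  (fun s => derive_sq v (e1 R) (s, w.2 + h * gamma)) w.1 (w.1 + h * alpha)
  (fun s hs => is_derive_sq1 (conj (between_open w1 hx hs) hy)).
have [c2 c2b e2'] := @mvt_unordered (fun s => v (w.1, s))
  (fun s => derive_sq v (e2 R) (w.1, s)) w.2 (w.2 + h * gamma)
  (fun s hs => is_derive_sq2 (conj w1 (between_open w2 hy hs))).
have := between_dist c1b; have := between_dist c2b.
rewrite ![_ + h * _ - _]addrAC !subrr => c2d c1d.
rewrite -!ltr_norml !add0r in dx dy.
have b1 : `|derive_sq v (e1 R) (c1, w.2 + h * gamma) - A| < eps / K.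
  apply: h1 => /=; last first.
    by rewrite addrAC subrr add0r (lt_le_trans dy) // ge_min lexx.
  by rewrite (le_lt_trans c1d) // add0r (lt_le_trans dx) // ge_min lexx.
have b2 : `|derive_sq v (e2 R) (w.1, c2) - B| < eps / K.
  apply: h2 => /=; first by rewrite subrr normr0.
  by rewrite (le_lt_trans c2d) // add0r (lt_le_trans dy) // ge_min lexx orbT.
move: e1' e2' b1 b2; set A' := derive_sq v _ (c1, _); set B' := derive_sq v _ (_, c2).
move=> e1' e2' b1 b2.
have -> : h^-1 *: (((fun s : R => v (x + alpha * s, y + gamma * s)) \o shift t) (h *: 1)
      - v w) = alpha * A' + gamma * B'.
  rewrite /= /shift /= -[h *: 1]/(h * 1) mulr1 -[_ *: _]/(_ * _).
  have -> : (x + alpha * (h + t), y + gamma * (h + t)) = (w.1 + h * alpha, w.2 + h * gamma).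
    by rewrite /w /=; congr (_, _); ring.
  rewrite (_ : v _ - v w = h * (alpha * A' + gamma * B')) ?mulKf //.
  rewrite (_ : _ - _ = (v (w.1 + h * alpha, w.2 + h * gamma) - v (w.1, w.2 + h * gamma))
     + (v (w.1, w.2 + h * gamma) - v (w.1, w.2))); last first.
    by rewrite addrA subrK.
  by rewrite e1' e2'; ring.
rewrite distrC (_ : _ - _ = alpha * (A' - A) + gamma * (B' - B)); last by ring.
apply: le_lt_trans (ler_normD _ _) _; rewrite !normrM.
have E : eps = K * (eps / K) by rewrite mulrC divfK // gt_eqF.
rewrite [ltRHS]E /K; move: (eps / K) eK b1 b2 => ek ek0 b1 b2.
have n1 := normr_ge0 alpha; have n2 := normr_ge0 gamma.
by nra.
Unshelve. all: by end_near. Qed.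

Lemma mvt_path (x y alpha gamma s t : R) : s <= t ->
  (forall z, s <= z <= t -> open_square (x + alpha * z, y + gamma * z)) ->
  exists2 w, open_square w &
    v (x + alpha * t, y + gamma * t) - v (x + alpha * s, y + gamma * s) =
    (alpha * derive_sq v (e1 R) w + gamma * derive_sq v (e2 R) w) * (t - s).
Proof.
move=> st h.
have [|c] := @mvt_unordered (fun z => v (x + alpha * z, y + gamma * z))
  (fun z => alpha * derive_sq v (e1 R) (x + alpha * z, y + gamma * z) +
     gamma * derive_sq v (e2 R) (x + alpha * z, y + gamma * z)) s t.
  by move=> z; rewrite (min_idPl st) (max_idPr st) => /h; exact: is_derive_path.
rewrite (min_idPl st) (max_idPr st) => /h hc e.
by exists (x + alpha * c, y + gamma * c).
Qed.

End InteriorDerivative.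

(** * Logarithmic poles *)

Section LogarithmicPole.
Variable R : realType.
Local Notation mu := (@lebesgue_measure R).
Local Notation I := (`[0 : R, 1[%classic).
Local Open Scope ereal_scope.
Variables (a z : R).
Hypothesis a0 : (0 < a)%R.

(** With this radius [near_pole j] is the set where [a * |x - z| <= 2^-j], so [log_pole] counts the
    dyadic scales around [z] that contain [x]. *)
Let r j : R := ((a * 2 ^+ j)^-1)%R.
Let near_pole j : set R := `[(z - r j)%R, (z + r j)%R]%classic.

(* A majorant of [-ln (a * |x - z|)] with value [+oo] at the pole. *)
Definition log_pole (x : R) : \bar R :=
  \sum_(0 <= j <oo) (\1_(near_pole j) x)%:E.

Let r_gt0 j : (0 < r j)%R.
Proof. by rewrite invr_gt0 mulr_gt0 // exprn_gt0. Qed.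

Let near_poleE j x : near_pole j x <-> (`|x - z| <= r j)%R.
Proof. by rewrite /near_pole /= in_itv /= ler_distl. Qed.

Let measurable_near_pole j : measurable (near_pole j).
Proof. exact: measurable_itv. Qed.

Let measurable_near_pole_indic j :
  measurable_fun I (fun x => (\1_(near_pole j) x)%:E : \bar R).
Proof. by apply/measurable_EFinP; apply: measurable_indic. Qed.

Lemma log_pole_ge0 x : 0 <= log_pole x.
Proof. by apply: nneseries_ge0 => j _ _; rewrite lee_fin. Qed.

Lemma measurable_log_pole : measurable_fun I log_pole.
Proof.
by apply: (@ge0_emeasurable_sum _ _ _ _ (fun j x => (\1_(near_pole j) x)%:E) xpredT).
Qed.

(** The interval of index [j] has length [2 * r j = (4 / a) / 2^(j+1)], a geometric series with sum
    [4 / a]. *)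
Lemma integral_log_pole : \int[mu]_(x in I) log_pole x <= (4 / a)%:E.
Proof.
rewrite integral_nneseries; first last.
- by move=> j x _; rewrite lee_fin.
- exact: measurable_near_pole_indic.
- exact: measurable_itv.
apply: le_trans (@epsilon_trick0 R (4 / a)%R xpredT _); last by rewrite divr_ge0 // ltW.
apply: lee_nneseries => [j _ _|j _]; first by apply: integral_ge0 => x _; rewrite lee_fin.
rewrite integral_indic; [|exact: measurable_itv|exact: measurable_near_pole].
have -> : (4 / a / (2 ^ j.+1)%:R = 2 * r j)%R.
  by rewrite natrX exprS /r !invfM; field; rewrite expf_neq0 //= gt_eqF.
have <- : mu (near_pole j) = (2 * r j)%:E.
  rewrite lebesgue_measure_itv /= lte_fin ltrD2l gtrN ?r_gt0 //.
  by rewrite -EFinD; congr EFin; ring.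
apply: le_measure.
- by rewrite inE; apply: measurableI; [exact: measurable_near_pole|exact: measurable_itv].
- by rewrite inE; exact: measurable_near_pole.
- by move=> x [].
Qed.

Lemma log_pole_ge x J : (forall j, (j < J)%N -> (`|x - z| <= r j)%R) ->
  J%:R%:E <= log_pole x.
Proof.
move=> h.
apply: le_trans (@nneseries_lim_ge R (fun j => (\1_(near_pole j) x)%:E) xpredT 0 J _); last first.
  by move=> j _ _; rewrite lee_fin.
rewrite sumEFin lee_fin big_mkord.
rewrite (eq_bigr (fun=> 1%R)); first by rewrite sumr_const card_ord.
by move=> j _; rewrite indicE mem_set //; apply/near_poleE/h.
Qed.

(** The infinite value makes estimates trivial at the pole, so no exceptional null set has to be
    removed. *)
Lemma log_pole_infty : log_pole z = +oo.
Proof.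
apply: eq_infty => t.
apply: (le_trans _ (@log_pole_ge z (Num.truncn `|t|).+1 _)); last first.
  by move=> j _; rewrite subrr normr0 ltW.
by rewrite lee_fin (le_trans (ler_norm t)) // ltW // truncnS_gt.
Qed.

(** For the least [J] with [2^-J < a * |x - z|], the first [J] intervals contain [x], and
    [-ln (a * |x - z|) <= J * ln 2 <= J]. *)
Lemma log_pole_ln x : x != z -> (- ln (a * `|x - z|))%:E <= log_pole x.
Proof.
move=> xz.
have d0 : (0 < `|x - z|)%R by rewrite normr_gt0 subr_eq0.
have y0 : (0 < a * `|x - z|)%R by rewrite mulr_gt0.
have ex : exists j, ((2 ^+ j)^-1 < a * `|x - z|)%R.
  have [N _ /(_ N (leqnn N))] := near_infty_natSinv_expn_lt (PosNum y0).
  by rewrite /= div1r; exists N.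
case: (ex_minnP ex) => J hJ hmin.
apply: le_trans (@log_pole_ge x J _); last first.
  move=> j jJ; rewrite leNgt; apply/negP => lt.
  have := hmin j; rewrite leqNgt jJ => /(_ _)/negP; apply=> //.
  by move: lt; rewrite /r invfM mulrC ltr_pdivrMr // mulrC.
rewrite lee_fin lerNl.
apply: le_trans (_ : ln ((2 ^+ J)^-1) <= _)%R; last first.
  by rewrite ler_ln ?posrE ?invr_gt0 ?exprn_gt0 // ltW.
rewrite lnV ?posrE ?exprn_gt0 // lnXn // lerN2.
rewrite -[leLHS]mulr_natl -[leRHS]mulr1 ler_wpM2l //.
by rewrite (_ : 2 = 1 + 1)%R // le_ln1Dx // ltrN10.
Qed.

End LogarithmicPole.

(** * Convergence of averages of subadditive sequences *)

Section Fekete.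
Variable R : realType.

Lemma subadditive_le (a : nat -> R) m n q :
  (forall m n, a (m + n)%N <= a m + a n) -> a (q * m + n)%N <= q%:R * a m + a n.
Proof.
move=> sub; elim: q => [|q IH]; first by rewrite mul0n mul0r add0r.
rewrite mulSn -addnA; apply: le_trans (sub _ _) _.
by rewrite -natr1 mulrDl mul1r; lra.
Qed.

Lemma fekete (a : nat -> R) : (forall n, 0 <= a n) ->
  (forall m n, a (m + n)%N <= a m + a n) ->
  cvgn (fun n : nat => n%:R^-1 * a n).
Proof.
move=> a0 sub; pose b n := n%:R^-1 * a n; rewrite -[X in cvgn X]/b.
(* The limit is the infimum over positive indices; index 0 is left out because [b 0 = 0] by the
   convention [0^-1 = 0]. *)
pose S := [set b n.+1 | n in [set: nat]].
have bge0 n : 0 <= b n by rewrite mulr_ge0 ?invr_ge0.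
have hS : has_inf S.
  split; first by exists (b 1%N), 0%N.
  by exists 0 => _ [n _ <-].
pose l := inf S; suff : b n @[n --> \oo] --> l by move=> h; apply/cvg_ex; exists l.
apply/cvgrPdist_le => e e0.
have e2 : 0 < e / 2 by rewrite divr_gt0.
have [_ [m _ <-] hm] := inf_adherent e2 hS.
(* [B] dominates [a] at every remainder modulo [m.+1]; Euclidean division then gives
   [a n <= n * b m.+1 + B], and [B] is negligible against [n]. *)
pose B := \sum_(i < m.+1) a i.
have B0 : 0 <= B by rewrite sumr_ge0.
have aB i : (i < m.+1)%N -> a i <= B.
  move=> im; rewrite /B (bigD1 (Ordinal im)) //= lerDl.
  by rewrite sumr_ge0.
exists (Num.truncn (B / (e / 2))).+1 => // n /= hn.
have n0 : (0 < n)%N by apply: leq_trans hn.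
have nR : 0 < n%:R :> R by rewrite ltr0n.
have lb : l <= b n.
  apply: ge_inf; first by case: hS.
  by exists n.-1; rewrite // prednK.
have Bn : B <= (e / 2) * n%:R.
  have : B / (e / 2) < (Num.truncn (B / (e / 2))).+1%:R by exact: truncnS_gt.
  rewrite ltr_pdivrMr // => /ltW/le_trans; apply.
  by rewrite mulrC ler_wpM2l ?ler_nat // ltW.
rewrite distrC ger0_norm ?subr_ge0 // lerBlDl.
have an : a n <= n%:R * b m.+1 + B.
  rewrite [X in a X](divn_eq n m.+1); apply: le_trans (subadditive_le _ _ _ sub) _.
  apply: lerD; last by apply: aB; rewrite ltn_mod.
  have -> : a m.+1 = m.+1%:R * b m.+1 by rewrite /b mulVKf // pnatr_eq0.
  rewrite mulrA -natrM ler_wpM2r // ler_nat.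
  by rewrite [leqRHS](divn_eq n m.+1) leq_addr.
rewrite /b ler_pdivrMl //.
apply: le_trans an _; rewrite mulrDr.
have : n%:R * b m.+1 <= n%:R * (l + e / 2) by rewrite ler_wpM2l // ltW.
lra.
Qed.

End Fekete.

(** * The mean of the cocycle and its lower bound on leaves *)

Lemma measure_unit_interval (R : realType) :
  lebesgue_measure (`[0, 1[%classic : set R) = 1%E.
Proof. by rewrite lebesgue_measure_itv /= lte_fin ltr01 oppr0 adde0. Qed.

Section CocycleIntegrals.
Variables (R : realType) (M : 'M[int]_2) (E lambda : R) (v : R * R -> R).
Hypothesis detM : \det M = 1.
Hypothesis v_bounded : exists V, forall w, unit_square R w -> `|v w| <= V.
Hypothesis v_measurable : measurable_fun (unit_square R) v.
Local Notation Q := (unit_square R).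
Local Notation T := (toral_map M).
Local Notation A := (cocycle M E lambda v).
Local Notation mu2 := (@lebesgue_measure R \x @lebesgue_measure R)%E.

Definition log_norm n w := ln (opnorm (A n w)).

Let T_preserving n : measure_preserving (iter n (@toral_map R M)).
Proof. exact/measure_preserving_iter/toral_map_preserving. Qed.

Let iter_square n w : Q w -> Q (iter n T w).
Proof. by case: (T_preserving n) => _ + _; apply. Qed.

Lemma measurable_cocycle n i j : measurable_fun Q (fun w => A n w i j).
Proof.
elim: n i j => [|n IH] i j; first exact: measurable_cst.
have mv : measurable_fun Q (fun w => E - lambda * v (iter n T w)).
  apply: measurable_funB; first exact: measurable_cst.
  apply: measurable_funM; first exact: measurable_cst.
  have [mT QT _] := T_preserving n.
  exact: (measurable_on_square_comp mT QT v_measurable).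
have mS k : measurable_fun Q (fun w => schrodinger_mx E lambda v (iter n T w) i k).
  under eq_fun do rewrite mxE.
  by case: (i == 0); case: (k == 0) => //; exact: measurable_cst.
rewrite (_ : (fun w => _) = (fun w => schrodinger_mx E lambda v (iter n T w) i 0 * A n w 0 j +
   schrodinger_mx E lambda v (iter n T w) i 1 * A n w 1 j)).
  by apply: measurable_funD; apply: measurable_funM.
by apply/funext => w; rewrite -mulmx2E.
Qed.

Lemma measurable_log_norm n : measurable_fun Q (log_norm n).
Proof.
apply: (measurableT_comp (@measurable_ln R)).
apply: measurable_opnorm; first exact: measurable_unit_square.
exact: measurable_cocycle.
Qed.

Lemma opnorm_cocycle_ge1 n w : 1 <= opnorm (A n w).
Proof. by apply: opnorm_ge1; exact: det_cocycle. Qed.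

Lemma opnorm_cocycle_gt0 n w : 0 < opnorm (A n w).
Proof. exact: lt_le_trans ltr01 (opnorm_cocycle_ge1 n w). Qed.

Lemma log_norm_ge0 n w : 0 <= log_norm n w.
Proof. exact/ln_ge0/opnorm_cocycle_ge1. Qed.

Lemma log_normD m n w : log_norm (m + n) w <= log_norm m (iter n T w) + log_norm n w.
Proof.
rewrite /log_norm -lnM ?posrE ?opnorm_cocycle_gt0 // ler_ln ?posrE ?mulr_gt0 ?opnorm_cocycle_gt0 //.
by rewrite cocycleD; exact: opnormM.
Qed.

Lemma log_norm_entry n w : A n w 0 0 != 0 -> ln `|A n w 0 0| <= log_norm n w.
Proof.
move=> nz; rewrite ler_ln ?posrE ?normr_gt0 ?opnorm_cocycle_gt0 //.
exact: opnorm_ge_entry.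
Qed.

(** One step has norm at most [b] by the Frobenius bound, and submultiplicativity iterates this. It
    makes the integrals of the log norms finite. *)
Lemma log_norm_bounded : exists B, forall n w, Q w -> log_norm n w <= n%:R * B.
Proof.
have [V hV] := v_bounded; pose b := `|E| + `|lambda| * V + 2.
exists (ln b) => n w wQ.
have step k : log_norm 1 (iter k T w) <= ln b.
  have wk := iter_square k wQ; have Vk := hV _ wk.
  have hb : `|E - lambda * v (iter k T w)| <= b - 2.
    rewrite /b addrK; apply: le_trans (ler_normB _ _) _.
    by rewrite lerD2l normrM ler_wpM2l.
  have b2 : 0 <= b - 2 by apply: le_trans hb.
  rewrite ler_ln ?posrE ?opnorm_cocycle_gt0 //; last by lra.
  rewrite -(@ler_pXn2r _ 2) ?nnegrE ?opnorm_ge0 //; last by lra.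
  apply: le_trans (opnorm_le_frobenius _) _.
  rewrite /= mulmx1 /gram_mean; have [-> -> -> ->] := schrodinger_mxE E lambda v (iter k T w).
  have : `|E - lambda * v (iter k T w)| ^+ 2 <= (b - 2) ^+ 2.
    by rewrite ler_pXn2r ?nnegrE.
  rewrite real_normK ?num_real // sqrrN expr1n expr0n /=; nra.
elim: n => [|n IH].
  have [x x1 h] := enorm_mulmx_attained (1%:M : 'M[R]_2).
  by rewrite /log_norm mul0r opnormE -h mul1mx x1 ln1.
have := log_normD 1 n w; rewrite add1n => h; apply: le_trans h _.
by rewrite -natr1 mulrDl mul1r addrC; apply: lerD.
Qed.

Local Open Scope ereal_scope.

Lemma measurable_log_norm_EFin n : measurable_fun Q (fun w => (log_norm n w)%:E).
Proof. by apply/measurable_EFinP; exact: measurable_log_norm. Qed.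

Lemma square_measure : mu2 Q = 1.
Proof.
pose I : set R := `[0%R, 1%R[%classic.
transitivity (@lebesgue_measure R I * @lebesgue_measure R I).
  by apply: product_measure1E; exact: measurable_itv.
by rewrite measure_unit_interval mule1.
Qed.

Lemma integral_log_norm_fin n : \int[mu2]_(w in Q) (log_norm n w)%:E \is a fin_num.
Proof.
have [B hB] := log_norm_bounded.
rewrite ge0_fin_numE; last by apply: integral_ge0 => w _; rewrite lee_fin log_norm_ge0.
apply: (@le_lt_trans _ _ (\int[mu2]_(w in Q) (cst (n%:R * B)%:E) w)).
  apply: ge0_le_integral.
  - exact: measurable_unit_square.
  - by move=> w _; rewrite lee_fin log_norm_ge0.
  - exact: measurable_log_norm_EFin.
  - exact: measurable_cst.
  - by move=> w wQ; rewrite lee_fin; exact: hB.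
rewrite integral_cst; last exact: measurable_unit_square.
rewrite [X in _ * X](_ : _ = 1); last exact: square_measure.
by rewrite mule1 ltry.
Qed.

Definition mean_log_norm n : R := (\int[mu2]_(w in Q) log_norm n w)%R.

Lemma mean_log_normE n :
  (mean_log_norm n)%:E = \int[mu2]_(w in Q) (log_norm n w)%:E.
Proof. by rewrite /mean_log_norm /Rintegral fineK // integral_log_norm_fin. Qed.

Lemma mean_log_norm_ge0 n : (0 <= mean_log_norm n)%R.
Proof.
rewrite -lee_fin mean_log_normE; apply: integral_ge0 => w _.
by rewrite lee_fin log_norm_ge0.
Qed.

(** Integrate [log_normD]; the invariance of the measure under the [n]-th iterate of [T] removes the
    shift in the first term. *)
Lemma mean_log_normD m n : (mean_log_norm (m + n)%N <= mean_log_norm m + mean_log_norm n)%R.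
Proof.
have [mT QT iT] := T_preserving n.
have mm := measurable_on_square_comp mT QT (measurable_log_norm_EFin m).
have ge0 k w : 0 <= (log_norm k w)%:E by rewrite lee_fin log_norm_ge0.
have sub : \int[mu2]_(w in Q) (log_norm (m + n) w)%:E <=
    \int[mu2]_(w in Q) (log_norm m w)%:E + \int[mu2]_(w in Q) (log_norm n w)%:E.
  have <- := iT _ (measurable_log_norm_EFin m) (fun w _ => ge0 m w).
  rewrite -ge0_integralD //; [|exact: measurable_unit_square|exact: measurable_log_norm_EFin].
  apply: ge0_le_integral => //.
  - exact: measurable_unit_square.
  - exact: measurable_log_norm_EFin.
  - by apply: emeasurable_funD => //; exact: measurable_log_norm_EFin.
  - by move=> w _; rewrite -EFinD lee_fin; exact: log_normD.
have fin k := integral_log_norm_fin k.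
have finD : \int[mu2]_(w in Q) (log_norm m w)%:E + \int[mu2]_(w in Q) (log_norm n w)%:E
    \is a fin_num.
  by rewrite fin_numD; apply/andP; split; exact: fin.
have := fine_le (fin (m + n)%N) finD sub.
by rewrite (fineD (fin m) (fin n)).
Qed.

Lemma cvg_mean_log_norm : cvgn (fun n : nat => (n%:R^-1 * mean_log_norm n)%R).
Proof. apply: fekete; [exact: mean_log_norm_ge0|exact: mean_log_normD]. Qed.

End CocycleIntegrals.

(** * Lower bound for the log norms along unstable leaves *)

Section LeafEstimate.
Variables (R : realType) (M : 'M[int]_2) (beta : R) (u : 'cV[R]_2) (v : R * R -> R) (c : R).
Hypothesis detM : \det M = 1.
Hypothesis beta_gt1 : 1 < beta.
Hypothesis u_neq0 : u != 0.
Hypothesis u_eigen : mx_real R M *m u = beta *: u.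
Hypothesis v_bounded : exists V, forall w, unit_square R w -> `|v w| <= V.
Hypothesis v_measurable : measurable_fun (unit_square R) v.
Hypothesis v_C1 : C1_square v.
Hypothesis c_gt0 : 0 < c.
Hypothesis v_mono : forall w, unit_square R w -> c < dir_derive u v w.
Variables (lambda E : R).
Hypothesis lambda_gt0 : 0 < lambda.
Local Notation mu := (@lebesgue_measure R).
Local Notation mu2 := (@lebesgue_measure R \x @lebesgue_measure R)%E.
Local Notation I := (`[0 : R, 1[%classic).
Local Notation Q := (unit_square R).
Local Notation T := (toral_map M).
Local Notation A := (cocycle M E lambda v).

Let r := u 1 0 / u 0 0.
Let u0 : u 0 0 != 0. Proof. by have [] := eigenvector_coords detM beta_gt1 u_neq0 u_eigen. Qed.
Let r0 : r != 0.
Proof.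
have [_ u1] := eigenvector_coords detM beta_gt1 u_neq0 u_eigen.
by rewrite mulf_neq0 // invr_neq0.
Qed.
Let beta0 : 0 < beta := lt_trans ltr01 beta_gt1.
Let beta_pow k : 1 <= beta ^+ k. Proof. by rewrite exprn_ege1 // ltW. Qed.

Let slope := c / `|u 0 0|.
Let slope0 : 0 < slope. Proof. by rewrite divr_gt0 // normr_gt0. Qed.

(** The parametrisation by the first coordinate makes [(x, y) |-> leaf y x] a measure-preserving
    shear. *)
Definition leaf (y x : R) : R * R := (x, frac (y + r * x)).

(** Increasing [x] moves along [u / u_1]; the sign factor makes the energy decrease between jumps
    whatever the sign of [u_1]. *)
Definition leaf_energy (y : R) (k : nat) (x : R) : R :=
  Num.sg (u 0 0) * (E - lambda * v (iter k T (leaf y x))).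

(** The breakpoints are where a coordinate of the image path, of velocity [beta^k * (1, r)], meets
    an integer: at most [beta^k + 2] and [beta^k * |r| + 2] points. Between them the path stays in
    the open square and the mean value theorem applies. *)
Lemma leaf_energy_decr y k : exists2 D : seq R,
  (size D)%:R <= (5 + `|r|) * beta ^+ k &
  decr (lambda * slope * beta ^+ k) D (leaf_energy y k).
Proof.
have [p [q lf]] := leaf_iter detM beta_gt1 u_neq0 u_eigen y k.
rewrite -/r in lf.
have bk0 : beta ^+ k != 0 by rewrite expf_neq0 // gt_eqF.
have [S1 s1 h1] := int_crossings p bk0.
have [S2 s2 h2] := int_crossings q (mulf_neq0 bk0 r0).
have bk := beta_pow k.
have bk1 : 0 < beta ^+ k := lt_le_trans ltr01 bk.
exists (S1 ++ S2).
  rewrite size_cat natrD; apply: le_trans (lerD s1 s2) _.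
  by rewrite normrM ger0_norm ?(ltW bk1) //; lra.
move=> x z x0 xz z1 fr.
have ni1 t : x <= t <= z -> p + beta ^+ k * t \isn't a Num.int.
  move=> /[dup] xtz /andP[xt tz]; apply/negP => /h1 h.
  have := fr t; rewrite mem_cat h ?xtz //; last by lra.
  by move=> /(_ isT).
have ni2 t : x <= t <= z -> q + beta ^+ k * r * t \isn't a Num.int.
  move=> /[dup] xtz /andP[xt tz]; apply/negP => /h2 h.
  have := fr t; rewrite mem_cat h ?orbT ?xtz //; last by lra.
  by move=> /(_ isT).
have [p' hp] := frac_affine (ltW xz) ni1.
have [q' hq] := frac_affine (ltW xz) ni2.
have val t : x <= t <= z -> v (iter k T (leaf y t)) = v (p' + beta ^+ k * t, q' + beta ^+ k * r * t).
  move=> xtz; rewrite lf; last by lra.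
  by have [-> _] := hp t xtz; have [-> _] := hq t xtz.
have [|w w0 mvt] := mvt_path v_C1 (x := p') (y := q') (alpha := beta ^+ k)
    (gamma := beta ^+ k * r) (ltW xz).
  by move=> t xtz; split; [have [] := hp t xtz|have [] := hq t xtz].
rewrite /leaf_energy !val ?lexx ?(ltW xz) //.
have dir := v_mono (open_square_sub w0).
have slopeE : Num.sg (u 0 0) * (beta ^+ k * derive_sq v (e1 R) w + beta ^+ k * r * derive_sq v (e2 R) w)
    = beta ^+ k * (dir_derive u v w / `|u 0 0|).
  have sg0 : Num.sg (u 0 0) != 0 by rewrite sgr_eq0.
  have sgV : (Num.sg (u 0 0))^-1 = Num.sg (u 0 0).
    by apply: (mulfI sg0); rewrite mulfV // -expr2 sqr_sg u0.
  rewrite /dir_derive /r normrEsg invfM sgV; move: (Num.sg _) => sg.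
  by field; exact: u0.
set dv1 := v (p' + _ * x, _) in mvt *; set dv2 := v (p' + _ * z, _) in mvt *.
have : slope * beta ^+ k * (z - x) <= Num.sg (u 0 0) * (dv2 - dv1).
  rewrite mvt mulrA slopeE ler_wpM2r ?subr_ge0 ?(ltW xz) //.
  rewrite mulrC ler_wpM2l ?(ltW bk1) // /slope ler_wpM2r ?invr_ge0 //.
  exact: ltW.
move=> /(ler_wpM2l (ltW lambda_gt0)).
rewrite mulrBr; lra.
Qed.

(** A common sign [s] on all energies multiplies the solution of the recurrence by [s^n], because
    [s^2 = 1]. *)
Lemma transfer_cocycle y n x :
  transfer (leaf_energy y) n x = Num.sg (u 0 0) ^+ n * A n (leaf y x) 0 0.
Proof.
have sg2 : Num.sg (u 0 0) ^+ 2 = 1 by rewrite sqr_sg u0.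
suff : transfer (leaf_energy y) n x = Num.sg (u 0 0) ^+ n * A n (leaf y x) 0 0 /\
  transfer (leaf_energy y) n.+1 x = Num.sg (u 0 0) ^+ n.+1 * A n.+1 (leaf y x) 0 0.
  by case.
elim: n => [|n [IH1 IH2]].
  split; first by rewrite /= mxE expr0 mulr1.
  by rewrite cocycleS00 /= !mxE /= mulr1 subr0 expr1.
split=> //.
rewrite [LHS]/= -/(transfer (leaf_energy y) n.+1 x) IH1 IH2.
rewrite [A n.+2 _ _ _]cocycleS00 cocycleS10 /leaf_energy !exprS.
move: sg2 (Num.sg (u 0 0) ^+ n); move: (Num.sg _) (A n.+1 _ 0 0) (A n _ 0 0) => s a b s2 P.
apply/eqP; rewrite -subr_eq0 (_ : _ - _ = (s ^+ 2 - 1) * P * b); last by ring.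
by rewrite s2 subrr !mul0r.
Qed.

Let zeros_const := 2 * ((5 + `|r| + 1) * beta / (beta - 2)).

(** At time [k] there are at most [zeros_const * beta^k] poles of integral at most
    [4 / (slope * beta^k)]: the powers of [beta] cancel, and neither [lambda] nor [E] enters. *)
Definition leaf_const := zeros_const * (4 / slope).

Let zeros_const_ge0 : 0 <= zeros_const.
Proof.
have b2 := beta_gt2 detM beta_gt1 u_neq0 u_eigen.
by rewrite mulr_ge0 // divr_ge0 ?subr_ge0 ?(ltW b2) // mulr_ge0 ?(ltW beta0).
Qed.

Lemma leaf_const_ge0 : 0 <= leaf_const.
Proof. by rewrite mulr_ge0 // divr_ge0 // ltW. Qed.

Local Open Scope ereal_scope.

Lemma leaf_majorant y n : exists H : R -> \bar R,
  [/\ measurable_fun I H, (forall x, 0 <= H x),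
   \int[mu]_(x in I) H x <= (n%:R * leaf_const)%:E &
   forall x, I x -> (n%:R * ln lambda)%:E <= (log_norm M E lambda v n (leaf y x))%:E + H x].
Proof.
have b2 := beta_gt2 detM beta_gt1 u_neq0 u_eigen.
have [D hD] := choice (fun k => let: ex_intro2 D h1 h2 := leaf_energy_decr y k in
  ex_intro (fun D => _ /\ _) D (conj h1 h2)).
have C0 : (0 <= 5 + `|r|)%R by rewrite addr_ge0.
have /choice[Z hZ] : forall k, exists S : seq R,
    ((size S)%:R <= zeros_const * beta ^+ k)%R /\
    forall x, (0 <= x < 1)%R -> x \notin S -> exists2 z, z \in S &
      (lambda * slope * beta ^+ k * `|x - z| <= `|riccati (leaf_energy y) k x|)%R.
  move=> k; have [S h1 h2] := riccati_zeros (mulr_gt0 lambda_gt0 slope0) b2 C0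
    (fun k => (hD k).2) (fun k => (hD k).1) k.
  by exists S.
have rate0 k : (0 < slope * beta ^+ k)%R by rewrite mulr_gt0 // exprn_gt0.
pose P k x := \sum_(z <- Z k) log_pole (slope * beta ^+ k) z x.
have P0 k x : 0 <= P k x by apply: sume_ge0 => z _; exact: log_pole_ge0.
have mP k : measurable_fun I (P k).
  by apply: emeasurable_sum => z; apply: measurable_log_pole.
exists (fun x => \sum_(k < n) P k x); split.
- by apply: emeasurable_sum => k; exact: mP.
- by move=> x; apply: sume_ge0.
- rewrite ge0_integral_sum //; last by move=> k; exact: mP.
  rewrite (_ : n%:R * leaf_const = \sum_(k < n) leaf_const)%R; last first.
    by rewrite sumr_const card_ord mulr_natl.
  rewrite -sumEFin; apply: lee_sum => k _.
  rewrite ge0_integral_sum //; [|by move=> z; exact: measurable_log_pole|by move=> z x _; exact: log_pole_ge0].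
  apply: (@le_trans _ _ (\sum_(z <- Z k) (4 / (slope * beta ^+ k))%:E)).
    by apply: lee_sum => z _; exact: integral_log_pole.
  rewrite sumEFin lee_fin big_const_seq count_predT iter_addr_0 -[leLHS]mulr_natl.
  have [sZ _] := hZ k.
  apply: (@le_trans _ _ (zeros_const * beta ^+ k * (4 / (slope * beta ^+ k)))%R).
    by rewrite ler_wpM2r // divr_ge0 // ltW.
  rewrite /leaf_const le_eqVlt; apply/orP; left; apply/eqP.
  by field; rewrite !gt_eqF // exprn_gt0.
- move=> x; rewrite /= in_itv /= => x01.
  have sum_ge (k : 'I_n) : P k x <= \sum_(k < n) P k x.
    by rewrite (bigD1 k) //= leeDl // sume_ge0.
  (* An infinite majorant leaves nothing to prove. Otherwise [x] avoids every pole, so no ratio of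
     index below [n] vanishes at [x]. *)
  have [Hoo|Hoo] := eqVneq (\sum_(k < n) P k x) +oo.
    by rewrite Hoo addey // leey.
  have notin (k : nat) : (k < n)%N -> x \notin Z k.
    move=> kn; apply: contra Hoo => xZ.
    rewrite -leye_eq; apply: le_trans (sum_ge (Ordinal kn)).
    rewrite /= /P (big_rem x) //= log_pole_infty // addye //.
    by rewrite gt_eqF // (lt_le_trans (ltNyr 0)) // sume_ge0 // => z _; exact: log_pole_ge0.
  have near k : (k < n)%N -> riccati (leaf_energy y) k x != 0%R /\
      (ln lambda - ln `|riccati (leaf_energy y) k x|)%:E <= P k x.
    move=> kn; have xZ := notin _ kn; have [_ /(_ _ x01 xZ)[z zZ hz]] := hZ k.
    have xz : x != z by apply: contraNneq xZ => ->.
    have d0 : (0 < slope * beta ^+ k * `|x - z|)%R.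
      by rewrite mulr_gt0 // normr_gt0 subr_eq0.
    have {}hz : (lambda * (slope * beta ^+ k * `|x - z|) <=
        `|riccati (leaf_energy y) k x|)%R by rewrite !mulrA in hz *.
    have f0 := lt_le_trans (mulr_gt0 lambda_gt0 d0) hz.
    split; first by rewrite -normr_gt0.
    apply: (@le_trans _ _ (log_pole (slope * beta ^+ k) z x)); last first.
      rewrite /P (big_rem z) //= leeDl // sume_ge0 // => t _; exact: log_pole_ge0.
    apply: le_trans (log_pole_ln (rate0 k) xz).
    rewrite lee_fin.
    have : (ln (lambda * (slope * beta ^+ k * `|x - z|)) <= ln `|riccati (leaf_energy y) k x|)%R.
      by rewrite ler_ln ?posrE // mulr_gt0.
    by rewrite lnM ?posrE //; lra.
  have [t0 lt] := ln_transfer (g := leaf_energy y) (n := n) (x := x) (fun k kn => (near k kn).1).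
  have e : (`|transfer (leaf_energy y) n x| = `|A n (leaf y x) 0 0|)%R.
    by rewrite transfer_cocycle normrM normrX normr_sg u0 expr1n mul1r.
  have a0 : A n (leaf y x) 0%R 0%R != 0%R by rewrite -normr_gt0 -e normr_gt0.
  have := log_norm_entry a0; rewrite -e lt => hL.
  (* [n * ln lambda] is split into the logarithms of the ratios, bounded by the log norm, and the
     deficits, bounded by the poles. *)
  apply: (@le_trans _ _ ((\sum_(k < n) ln `|riccati (leaf_energy y) k x|)%:E +
     (\sum_(k < n) (ln lambda - ln `|riccati (leaf_energy y) k x|))%:E)).
    by rewrite -EFinD lee_fin -big_split /= (eq_bigr (fun=> ln lambda)) => [|k _];
       rewrite ?sumr_const ?card_ord ?mulr_natl // addrCA subrr addr0.
  apply: leeD; first by rewrite lee_fin.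
  by rewrite -sumEFin; apply: lee_sum => k _; have [] := near k (ltn_ord k).
Qed.

Lemma leaf_bound y n : I y -> (0 <= ln lambda)%R ->
  (n%:R * (ln lambda - leaf_const))%:E <=
  \int[mu]_(x in I) (log_norm M E lambda v n (leaf y x))%:E.
Proof.
move=> yI l0; have [H [mH H0 iH leH]] := leaf_majorant y n.
have mI : measurable I by exact: measurable_itv.
have mL : measurable_fun I (fun x => (log_norm M E lambda v n (leaf y x))%:E).
  have [mS QS _] := measure_preserving_shear1 r.
  have mF := measurable_log_norm_EFin E lambda detM v_measurable n.
  exact: (measurable_section2 yI (measurable_on_square_comp mS QS mF)).
have L0 x : 0 <= (log_norm M E lambda v n (leaf y x))%:E.
  by rewrite lee_fin log_norm_ge0.
rewrite mulrBr EFinB leeBlDr //.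
apply: le_trans (leeD (lexx _) iH).
rewrite -ge0_integralD //.
apply: (@le_trans _ _ (\int[mu]_(x in I) (cst (n%:R * ln lambda)%:E) x)).
  rewrite integral_cst // [X in _ * X](_ : _ = 1) ?mule1 //.
  exact: measure_unit_interval.
apply: ge0_le_integral => //.
- by move=> x _; rewrite lee_fin mulr_ge0.
- by apply: emeasurable_funD.
Qed.

Lemma mean_log_norm_ge n :
  (n%:R * (ln lambda - leaf_const) <= mean_log_norm M E lambda v n)%R.
Proof.
(* For small [lambda] the left side is nonpositive and the mean nonnegative. The other case has
   [0 <= ln lambda], so only nonnegative functions are integrated. *)
have [neg|pos] := leP (ln lambda) leaf_const.
  by apply: (@le_trans _ _ 0%R); rewrite ?mean_log_norm_ge0 // mulr_ge0_le0 // subr_le0.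
have l0 : (0 <= ln lambda)%R by rewrite (le_trans leaf_const_ge0) // ltW.
have mI : measurable I by exact: measurable_itv.
rewrite -lee_fin (mean_log_normE _ _ detM v_bounded v_measurable).
have [mS QS iS] := measure_preserving_shear1 r.
have mF := measurable_log_norm_EFin E lambda detM v_measurable n.
have mG := measurable_on_square_comp mS QS mF.
have F0 w : 0 <= (log_norm M E lambda v n w)%:E by rewrite lee_fin log_norm_ge0.
(* The shear turns the mean over the square into an average over the leaves, with [x] running along
   the leaf and [y] indexing it. *)
have <- := iS _ mF (fun w _ => F0 w).
rewrite (integral_square2 mG (fun w _ => F0 _)).
apply: (@le_trans _ _ (\int[mu]_(y in I) (cst (n%:R * (ln lambda - leaf_const))%:E) y)).
  rewrite integral_cst // [X in _ * X](_ : _ = 1) ?mule1 //.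
  exact: measure_unit_interval.
apply: ge0_le_integral => //.
- by move=> y _; rewrite lee_fin mulr_ge0 // subr_ge0 ltW.
- by apply: (measurable_integral_square2 mG) => w _; exact: F0.
- by move=> y yI; exact: leaf_bound.
Qed.

End LeafEstimate.

Theorem theorem2 (R : realType) (M : 'M[int]_2) (beta : R) (u : 'cV[R]_2)
  (v : R * R -> R)
  (detM : \det M = 1)
  (hypM : hyperbolic R M)
  (beta_gt1 : 1 < beta)
  (eig_beta : eigenvalue (mx_real R M) beta)
  (eig_betaV : eigenvalue (mx_real R M) beta^-1)
  (u_neq0 : u != 0)
  (u_eigen : mx_real R M *m u = beta *: u)
  (v_bounded : [bounded v w | w in unit_square R])
  (v_measurable : measurable_fun (unit_square R) v)
  (v_C1 : C1_square v)
  (v_mono : exists2 c : R, 0 < c &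
     forall w, unit_square R w -> c < dir_derive u v w) :
  exists2 C0 : R, 0 < C0 &
    forall lambda : R, 0 < lambda ->
      forall E : R, ln lambda - C0 < lyapunov M v E lambda.
Proof.
have [c c0 hc] := v_mono.
have bnd : exists V, forall w, unit_square R w -> `|v w| <= V.
  have [V [_ hV]] := v_bounded.
  by exists (V + 1) => w; apply: hV; rewrite ltrDl.
have C0 := leaf_const_ge0 detM beta_gt1 u_neq0 u_eigen c0.
(* The added 1 makes the constant positive and the final inequality strict. *)
exists (leaf_const beta u c + 1) => [|lambda l0 E]; first by rewrite ltr_pwDr.
apply: (@lt_le_trans _ _ (ln lambda - leaf_const beta u c)).
  by rewrite opprD addrA gtrDl oppr_lt0 ltr01.
apply: limr_ge; first exact: cvg_mean_log_norm.
(* The bound on the averages is used from [n = 1] on, where division by [n] is genuine. *)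
exists 1%N => // n /= n0.
rewrite ler_pdivlMl ?ltr0n //.
exact: (mean_log_norm_ge detM beta_gt1 u_neq0 u_eigen bnd v_measurable v_C1 c0 hc E l0 n).
Qed.
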